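(* Let $k$ be an algebraically closed field of characteristic zero, let $C$ be a smooth projective curve over $k$ of genus $g\ge2$, let $n\ge2$, and let $t:C\to\mathbb P^1$ be a cyclic morphism of degree $n$ (that is, $k(C)/k(t)$ is Galois with cyclic Galois group of order $n$) with branch data $(l_1,\dots,l_r)$, the point at infinity included when it is a branch point. Then there is a birational map from $C$ to a curve $v^n=h(u)$ with $k(u)=k(t)$ and $h\in k[u]$ separable if and only if there is $c\in(\mathbb Z/n\mathbb Z)^\times$ such that $$c\,l_j\equiv 1\pmod n\quad\text{for every } j\in\{1,\dots,r\}\text{ with at most one exception.}$$
   Context: Fix a primitive $n$-th root of unity $\zeta_n\in k$. Branch data: let $\tau$ be a generator of $\operatorname{Gal}(k(C)/k(t))$, let $p_1,\dots,p_r\in\mathbb P^1$ be the branch points of $t$ (including $\infty$ if it is a branch point), and let $R$ be a point of $C$ above $p_j$ with ramification index $e$. The stabiliser of $R$ in $\langle\tau\rangle$ has a distinguished generator, the element acting on a uniformiser $t_R$ at $R$ by multiplication by $\zeta_n^{n/e}$ modulo $t_R^2$; it is written $\tau^{l_j}$ with $l_j\in\{1,\dots,n-1\}$ (independent of $R$ above $p_j$). The tuple $(l_1,\dots,l_r)$ is the branch data; changing the generator $\tau$ multiplies all $l_j$ by one common unit modulo $n$. Equivalently, in an affine model $y^n=\prod_{j=1}^s(x-p_j)^{l_j}$ with $x=t$, $\tau(x,y)=(x,\zeta_ny)$, $p_j\in k$ distinct, $l_j\in\{1,\dots,n-1\}$ and $\gcd(n,l_1,\dots,l_s)=1$, the finite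 branch points have data $l_j$, and $\infty$ is a branch point if and only if $n\nmid\sum_j l_j$, with datum $l_\infty\equiv-\sum_j l_j \pmod n$. *)

(* Defs.v *)
From HB Require Import structures.
From mathcomp Require Import all_boot all_order all_algebra all_fingroup.
From mathcomp Require Import all_solvable all_field.
From mathcomp Require Import mpoly.

Set Implicit Arguments.
Unset Strict Implicit.
Unset Printing Implicit Defensive.

Import GRing.Theory.
Local Open Scope ring_scope.

Section ProjectiveModel.

Variables (k K : fieldType) (i : {rmorphism k -> K}).

(* A closed integral subvariety C of P^N over k together with an              *)
(* identification of its function field with K. It is given by its generic    *)
(* point gen = (x_0 : ... : x_N) in P^N(K): the homogeneous ideal of C        *)
(* consists of the forms vanishing at gen, and pv_fun says that K is the      *)
(* field of degree-0 fractions of the homogeneous coordinate ring of C.       *)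
(* C is a curve exactly when K has transcendence degree 1 over k; below, K    *)
(* is a finite extension of k(t).                                             *)
Record proj_variety := ProjVariety {
  pv_dim : nat;
  pv_gen : 'I_pv_dim.+1 -> K;
  pv_gen_neq0 : exists j, pv_gen j != 0;
  pv_fun : forall z : K, exists (d : nat) (F G : {mpoly k[pv_dim.+1]}),
    [/\ F \is d.-homog, G \is d.-homog, mmap i pv_gen G != 0
      & z = mmap i pv_gen F / mmap i pv_gen G]
}.

Variable C : proj_variety.

(* Homogeneous coordinates of closed points; proportional vectors give the    *)
(* same point, and every notion below only depends on the point.              *)
Definition coords := 'I_(pv_dim C).+1 -> k.

Definition on_variety (P : coords) : Prop :=
  (exists j, P j != 0) /\
  forall (d : nat) (F : {mpoly k[(pv_dim C).+1]}),
    F \is d.-homog -> mmap i (@pv_gen C) F = 0 -> F.@[P] = 0.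

(* z in O_{C,P} *)
Definition in_local_ring (P : coords) (z : K) : Prop :=
  exists (d : nat) (F G : {mpoly k[(pv_dim C).+1]}),
    [/\ F \is d.-homog, G \is d.-homog, G.@[P] != 0, mmap i (@pv_gen C) G != 0
      & z = mmap i (@pv_gen C) F / mmap i (@pv_gen C) G].

(* z in the maximal ideal of O_{C,P} *)
Definition in_max_ideal (P : coords) (z : K) : Prop :=
  exists (d : nat) (F G : {mpoly k[(pv_dim C).+1]}),
    [/\ F \is d.-homog, G \is d.-homog, F.@[P] = 0, G.@[P] != 0 &
        mmap i (@pv_gen C) G != 0 /\
        z = mmap i (@pv_gen C) F / mmap i (@pv_gen C) G].

Definition is_local_unit (P : coords) (z : K) : Prop :=
  [/\ z != 0, in_local_ring P z & in_local_ring P z^-1].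

Definition is_uniformiser (P : coords) (pi : K) : Prop :=
  [/\ pi != 0, in_max_ideal P pi &
      forall z : K, z != 0 ->
        exists (m : int) (w : K), is_local_unit P w /\ z = w * pi ^ m].

(* Over an algebraically closed field, smoothness of a curve means that its   *)
(* local rings at closed points are discrete valuation rings.                 *)
Definition smooth_curve : Prop :=
  forall P, on_variety P -> exists pi, is_uniformiser P pi.

Definition order_at (P : coords) (z : K) (m : int) : Prop :=
  exists pi w, [/\ is_uniformiser P pi, is_local_unit P w & z = w * pi ^ m].

Definition is_derivation (D : K -> K) : Prop :=
  [/\ forall x y, D (x + y) = D x + D y,
      forall x y, D (x * y) = D x * y + x * D y
    & forall c : k, D (i c) = 0].

(* In characteristic 0 the k-derivations of the function field of a curve     *)
(* form a K-line; once D <> 0 is fixed, a rational differential omega is the  *)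
(* function f = omega(D), and dz is D z. Thus omega is regular at P iff       *)
(* omega lies in O_P d(pi), where pi is a uniformiser at P.                   *)
Definition regular_differential (D : K -> K) (f : K) : Prop :=
  forall P, on_variety P -> forall pi, is_uniformiser P pi ->
    exists w, in_local_ring P w /\ f = w * D pi.

(* The space of everywhere regular differentials has dimension g over k.      *)
Definition has_genus (g : nat) : Prop :=
  exists D : K -> K, [/\ is_derivation D, exists z, D z != 0 &
    exists b : 'I_g -> K,
      (forall j, regular_differential D (b j)) /\
      forall f, regular_differential D f ->
        exists! a : 'rV[k]_g, f = \sum_(j < g) i (a 0 j) * b j].

(* z in k(x) *)
Definition in_simple_ext (x z : K) : Prop :=
  exists A B : {poly k},
    (map_poly i B).[x] != 0 /\ z = (map_poly i A).[x] / (map_poly i B).[x].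

(* P(x, y), where the coefficients of P are polynomials in x. *)
Definition eval2 (P : {poly {poly k}}) (x y : K) : K :=
  (map_poly (fun A : {poly k} => (map_poly i A).[x]) P).[y].

(* The pair (x, y) of rational functions is a birational map from the curve   *)
(* with function field K to the irreducible affine plane curve F(x, y) = 0:   *)
(* it identifies K with the fraction field of k[x, y] / (F).                  *)
Definition birational_to_plane_curve (F : {poly {poly k}}) (x y : K) : Prop :=
  (forall P, eval2 P x y = 0 <-> exists Q, P = Q * F) /\
  (forall z, exists P Q, eval2 Q x y != 0 /\ z = eval2 P x y / eval2 Q x y).

End ProjectiveModel.

Section CyclicCover.

Variables (k : closedFieldType) (K : splittingFieldType {fraction {poly k}}).

(* The embedding of the constants k -> k(t) -> K. *)
Definition constK : {rmorphism k -> K} :=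
  (in_alg K \o @tofrac {poly k} \o @polyC k).

Definition tK : K := in_alg K (tofrac ('X : {poly k})).

Variable C : proj_variety constK.

(* Points of P^1(k) are elements of option k, None being infinity; this is    *)
(* a local parameter of P^1 at q, pulled back to C.                           *)
Definition param (q : option k) : K :=
  if q is Some a then tK - constK a else tK^-1.

Definition lies_above (R : coords C) (q : option k) : Prop :=
  on_variety R /\ in_max_ideal R (param q).

Definition ramification_index (R : coords C) (q : option k) (e : nat) : Prop :=
  order_at R (param q) e%:Z.

Definition is_branch_point (q : option k) : Prop :=
  exists (R : coords C) (e : nat),
    [/\ lies_above R q, ramification_index R q e & (1 < e)%N].

Definition stabilises (s : gal_of {:K}) (R : coords C) : Prop :=
  forall z : K, in_local_ring R z <-> in_local_ring R (s z).

(* The distinguished generator s of the stabiliser of R: it multiplies a      *)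
(* uniformiser at R by zeta^(n/e), modulo the square of the maximal ideal.    *)
Definition distinguished_generator
    (n : nat) (zeta : k) (R : coords C) (e : nat) (s : gal_of {:K}) : Prop :=
  [/\ s \in 'Gal({:K} / 1)%g, stabilises s R,
      forall s', s' \in 'Gal({:K} / 1)%g -> stabilises s' R -> s' \in <[s]>%g
    & forall pi, is_uniformiser R pi ->
        exists w, in_local_ring R w /\
          s pi - constK (zeta ^+ (n %/ e)) * pi = pi ^+ 2 * w].

Definition branch_data (n : nat) (zeta : k) (tau : gal_of {:K}) (r : nat)
    (p : 'I_r -> option k) (l : 'I_r -> nat) : Prop :=
  [/\ injective p,
      forall q, is_branch_point q <-> exists j, p j = q,
      forall j, (0 < l j < n)%N
    & forall (j : 'I_r) (R : coords C) (e : nat),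
        lies_above R (p j) -> ramification_index R (p j) e ->
        distinguished_generator n zeta R e (tau ^+ l j)%g].

End CyclicCover.

Arguments tK {k} K.
Arguments constK {k} K.

(* Main.v *)
Require Import Defs.
From mathcomp Require Import all_boot all_order all_algebra all_fingroup.
From mathcomp Require Import all_solvable all_field.
From mathcomp Require Import mpoly.
From mathcomp Require Import zify ring.
From mathcomp Require generic_quotient boolp classical_sets.
Import Order.TTheory GRing.Theory Num.Theory.
Local Open Scope ring_scope.

(* Let tau v = zeta^c v with c prime to n, so that v^n lies in k(t). At a     *)
(* point R above p_j, the distinguished generator tau^(l_j) multiplies v both *)
(* by zeta^(c l_j) and, through its action on a uniformiser, by zeta^a, where *)
(* a is the order of v^n at p_j; hence c l_j = a mod n, while n divides the   *)
(* order of v^n at the points that are not branch points.                     *)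
(* If v^n = h(u) with h separable and k(u) = k(t), then a is 0 or 1 at every  *)
(* p_j where u is finite, and u has a single pole. Conversely, Hilbert 90     *)
(* provides v; choose u with its pole at the exceptional branch point: v^n is *)
(* then a polynomial in u whose multiplicities are 0 or 1 mod n, up to an     *)
(* n-th power, so that v can be rescaled to make it separable. This direction *)
(* needs a point of C above every point of P^1, which comes from a valuation  *)
(* ring of K obtained by Zorn's lemma.                                        *)

(** By Kummer theory a model v^n = h(u) amounts to an eigenvector v of [tau] whose eigenvalue is a
    primitive n-th root of unity, together with a coordinate u of the t-line ([eigen_birational],
    [eigen_generates_coprime], [eigenvector_exists]). Only the divisor of v^n on the line modulo n
    is then constrained: [branch_congruence] computes it at the branch points and [unbranched_dvdn]
    elsewhere.

    If h is separable, [separable_multiplicity] bounds this divisor by 1 wherever u is finite, so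
    every exceptional branch point is a pole of u, and [pole_uniq] leaves only one. Conversely,
    [coordinate_avoiding] moves the exceptional point to the pole of u, and
    [separable_nth_power_part] splits off the n-th power that separates v^n from a separable
    polynomial. Both directions pass between multiplicities in u and orders on C through
    [rational_generator_param]; the converse also uses [center_over], the surjectivity of t on
    points. *)

Set Implicit Arguments.
Unset Strict Implicit.
Unset Printing Implicit Defensive.

(** * Local rings of a projective variety *)

Section LocalRing.

Variables (k K : fieldType) (i : {rmorphism k -> K}) (C : proj_variety i).
Variable P : coords C.
Hypothesis onP : on_variety P.

Local Notation O := (in_local_ring P).
Local Notation m := (in_max_ideal P).
Local Notation unit_at := (is_local_unit P).
Local Notation "F ^g" := (mmap i (@pv_gen _ _ i C) F) (at level 2).

(** Says that z is regular at P with value c. The residue field at P is k, so membership in the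
    local ring, in its maximal ideal and in its units all become statements about values, and values
    are compatible with the field operations. *)
Definition value_at (z : K) (c : k) := in_max_ideal P (z - i c).

Lemma on_variety_neq0 d (F : {mpoly k[(pv_dim C).+1]}) :
  F \is d.-homog -> F.@[P] != 0 -> F^g != 0.
Proof.
move=> hF; apply: contra => /eqP F0; apply/eqP.
by case: onP => _ /(_ d F hF F0).
Qed.

Lemma value_atP z c : value_at z c <->
  exists d F G, [/\ F \is d.-homog, G \is d.-homog, G.@[P] != 0,
    z = F^g / G^g & c = F.@[P] / G.@[P]].
Proof.
split=> [[d [F [G [hF hG F0 G0 [Gg0 zE]]]]]|[d [F [G [hF hG G0 -> ->]]]]].
  exists d, (F + c *: G), G; split=> //.
  - by rewrite rpredD // dhomogZ.
  - by rewrite -[z](subrK (i c)) zE mmapD mmapZ mulrDl mulfK.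
  - by rewrite mevalD mevalZ F0 add0r mulfK.
have Gg0 := on_variety_neq0 hG G0.
exists d, (F - (F.@[P] / G.@[P]) *: G), G; split=> //.
- by rewrite rpredB // dhomogZ.
- by rewrite mevalB mevalZ divfK // subrr.
- by split=> //; rewrite mmapB mmapZ mulrBl mulfK.
Qed.

Lemma value_at_const c : value_at (i c) c.
Proof.
apply/value_atP; exists 0%N, c%:MP, 1; split; rewrite ?dhomog1 //.
- by rewrite -[c%:MP]mulr1 mul_mpolyC dhomogZ // dhomog1.
- by rewrite meval1 oner_eq0.
- by rewrite mmapC rmorph1 divr1.
- by rewrite mevalC meval1 divr1.
Qed.

Lemma value_at_add z c z' c' :
  value_at z c -> value_at z' c' -> value_at (z + z') (c + c').
Proof.
move=> /value_atP[d [F [G [hF hG G0 -> ->]]]].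
move=> /value_atP[d' [F' [G' [hF' hG' G'0 -> ->]]]].
have [Gg0 G'g0] := (on_variety_neq0 hG G0, on_variety_neq0 hG' G'0).
apply/value_atP; exists (d + d')%N, (F * G' + F' * G), (G * G'); split.
- by apply: rpredD; last rewrite mulrC; apply: dhomogM.
- by rewrite dhomogM.
- by rewrite mevalM mulf_neq0.
- by rewrite mmapD !rmorphM /= addf_div.
- by rewrite mevalD !mevalM addf_div.
Qed.

Lemma value_at_mul z c z' c' :
  value_at z c -> value_at z' c' -> value_at (z * z') (c * c').
Proof.
move=> /value_atP[d [F [G [hF hG G0 -> ->]]]].
move=> /value_atP[d' [F' [G' [hF' hG' G'0 -> ->]]]].
apply/value_atP; exists (d + d')%N, (F * F'), (G * G'); split.
- by rewrite dhomogM.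
- by rewrite dhomogM.
- by rewrite mevalM mulf_neq0.
- by rewrite !rmorphM /= mulf_div.
- by rewrite !mevalM mulf_div.
Qed.

Lemma value_at_inv z c : value_at z c -> c != 0 -> value_at z^-1 c^-1.
Proof.
move=> /value_atP[d [F [G [hF hG G0 -> ->]]]] FG0.
apply/value_atP; exists d, G, F; split; rewrite ?invf_div //.
by apply: contraNneq FG0 => ->; rewrite mul0r.
Qed.

Lemma value_at_neq0 z c : value_at z c -> c != 0 -> z != 0.
Proof.
move=> /value_atP[d [F [G [hF hG G0 -> ->]]]] FG0.
rewrite mulf_neq0 ?invr_eq0 ?(on_variety_neq0 hG) // (on_variety_neq0 hF) //.
by apply: contraNneq FG0 => ->; rewrite mul0r.
Qed.

Lemma value_at_opp z c : value_at z c -> value_at (- z) (- c).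
Proof.
move=> zc; rewrite -mulN1r -[- c]mulN1r -(rmorph1 i) -rmorphN.
exact: value_at_mul (value_at_const _) zc.
Qed.

Lemma value_at_sub z c z' c' :
  value_at z c -> value_at z' c' -> value_at (z - z') (c - c').
Proof. by move=> zc z'c'; apply: value_at_add zc (value_at_opp z'c'). Qed.

Lemma value_at_uniq z c c' : value_at z c -> value_at z c' -> c = c'.
Proof.
move=> zc zc'; apply/eqP; rewrite -subr_eq0; apply/idPn=> cc'.
by have := value_at_neq0 (value_at_sub zc zc') cc'; rewrite subrr eqxx.
Qed.

Lemma in_max_value z : m z <-> value_at z 0.
Proof. by rewrite /value_at rmorph0 subr0. Qed.

Lemma in_local_value z : O z <-> exists c, value_at z c.
Proof.
split=> [[d [F [G [hF hG G0 _ ->]]]]|[c /value_atP]].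
  by exists (F.@[P] / G.@[P]); apply/value_atP; exists d, F, G.
move=> [d [F [G [hF hG G0 -> cE]]]]; exists d, F, G; split=> //.
exact: on_variety_neq0 hG G0.
Qed.

Lemma local_unit_value z : unit_at z <-> exists2 c, c != 0 & value_at z c.
Proof.
split=> [[z0 /in_local_value[c zc] /in_local_value[c' zc']]|[c c0 zc]].
  exists c => //; apply: contraTneq (oner_neq0 k) => c0.
  have := value_at_mul zc zc'; rewrite mulfV // c0 mul0r.
  rewrite -(rmorph1 i) => one0; rewrite negbK; apply/eqP.
  exact: value_at_uniq (value_at_const 1) one0.
split; first exact: value_at_neq0 zc c0.
  by apply/in_local_value; exists c.
by apply/in_local_value; exists c^-1; apply: value_at_inv.
Qed.

Lemma local_max_or_unit z : O z -> m z \/ unit_at z.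
Proof.
move=> /in_local_value[c zc]; have [c0|c0] := eqVneq c 0.
  by left; apply/in_max_value; rewrite -c0.
by right; apply/local_unit_value; exists c.
Qed.

Lemma max_not_unit z : m z -> unit_at z -> False.
Proof.
move=> /in_max_value z0 /local_unit_value[c c0 zc].
by move/eqP: c0; apply; apply: value_at_uniq zc z0.
Qed.

Lemma max_in_local z : m z -> O z.
Proof. by move=> /in_max_value z0; apply/in_local_value; exists 0. Qed.

Lemma unit_in_local z : unit_at z -> O z.
Proof. by case. Qed.

Lemma local_const c : O (i c).
Proof. by apply/in_local_value; exists c; apply: value_at_const. Qed.

Lemma local_add z z' : O z -> O z' -> O (z + z').
Proof.
move=> /in_local_value[c zc] /in_local_value[c' zc'].
by apply/in_local_value; exists (c + c'); apply: value_at_add.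
Qed.

Lemma local_mul z z' : O z -> O z' -> O (z * z').
Proof.
move=> /in_local_value[c zc] /in_local_value[c' zc'].
by apply/in_local_value; exists (c * c'); apply: value_at_mul.
Qed.

Lemma max_mulr z z' : O z -> m z' -> m (z * z').
Proof.
move=> /in_local_value[c zc] /in_max_value z'0.
by apply/in_max_value; rewrite -(mulr0 c); apply: value_at_mul.
Qed.

Lemma max_add z z' : m z -> m z' -> m (z + z').
Proof.
move=> /in_max_value z0 /in_max_value z'0.
by apply/in_max_value; rewrite -(addr0 0); apply: value_at_add.
Qed.

Lemma max_opp z : m z -> m (- z).
Proof.
by move=> /in_max_value z0; apply/in_max_value; rewrite -oppr0; apply: value_at_opp.
Qed.

Lemma max_const c : m (i c) -> c = 0.
Proof. by move=> /in_max_value; apply: value_at_uniq; apply: value_at_const. Qed.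

Lemma unit1 : unit_at 1.
Proof.
apply/local_unit_value; exists 1; rewrite ?oner_eq0 // -(rmorph1 i).
exact: value_at_const.
Qed.

Lemma unit_mul z z' : unit_at z -> unit_at z' -> unit_at (z * z').
Proof.
move=> /local_unit_value[c c0 zc] /local_unit_value[c' c'0 zc'].
by apply/local_unit_value; exists (c * c'); rewrite ?mulf_neq0 //; apply: value_at_mul.
Qed.

Lemma unit_inv z : unit_at z -> unit_at z^-1.
Proof.
by case=> z0 Oz Oz1; split; rewrite ?invr_eq0 ?invrK.
Qed.

Lemma value_at_expz z c (a : int) :
  value_at z c -> c != 0 -> value_at (z ^ a) (c ^ a).
Proof.
move=> zc c0; have zn (n : nat) : value_at (z ^+ n) (c ^+ n).
  elim: n => [|n IH]; first by rewrite !expr0 -(rmorph1 i); apply: value_at_const.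
  by rewrite !exprS; apply: value_at_mul.
case: a => n; first exact: zn.
by apply: value_at_inv; rewrite ?expf_neq0.
Qed.

Lemma unit_expz z (a : int) : unit_at z -> unit_at (z ^ a).
Proof.
move=> /local_unit_value[c c0 zc]; apply/local_unit_value.
by exists (c ^ a); [rewrite expfz_neq0 | apply: value_at_expz].
Qed.

Lemma value_at_horner u b (A : {poly k}) :
  value_at u b -> value_at (map_poly i A).[u] A.[b].
Proof.
move=> ub; elim/poly_ind: A => [|A c IH].
  by rewrite rmorph0 !horner0 -(rmorph0 i); apply: value_at_const.
rewrite rmorphD rmorphM /= map_polyX map_polyC !hornerE.
by apply: value_at_add (value_at_const c); apply: value_at_mul.
Qed.

Lemma max_expz z (a : int) : m z -> 0 < a -> m (z ^ a).
Proof.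
case: a => // -[//|n] mz _.
elim: n => [//|n IH]; rewrite /exprz exprS.
exact: max_mulr (max_in_local mz) IH.
Qed.

Lemma unit_exp_max z (a : int) : m z -> unit_at (z ^ a) -> a = 0.
Proof.
move=> mz ua; have [a0|a0|//] := ltgtP a 0.
  case: (@max_not_unit (z ^ (- a))); first by apply: max_expz; rewrite ?oppr_gt0.
  by rewrite -invr_expz; apply: unit_inv.
by case: (max_not_unit (max_expz mz a0)).
Qed.

(** Orders are well defined: no nonzero power of an element of the maximal ideal is a unit. Since z
    need not be a uniformiser, this also serves for parameters pulled back from the line. *)
Lemma unit_exp_uniq (z w w' : K) (a a' : int) : z != 0 -> m z -> unit_at w ->
  unit_at w' -> w * z ^ a = w' * z ^ a' -> a = a'.
Proof.
move=> z0 mz uw uw' E; apply/eqP; rewrite -subr_eq0; apply/eqP.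
apply: unit_exp_max mz _.
suff -> : z ^ (a - a') = w^-1 * w' by apply: unit_mul => //; apply: unit_inv.
have w0 : w != 0 by case: uw.
apply: (mulfI w0); rewrite mulVKf // expfzDr // mulrA E -mulrA -expfzDr //.
by rewrite subrr expr0z mulr1.
Qed.

End LocalRing.

(** * Existence of centres *)

Section Place.

Variables (k : closedFieldType) (K : fieldType) (i : {rmorphism k -> K}).
Variable w : K.
Hypothesis w_neq0 : w != 0.
Hypothesis w_transc : forall A : {poly k}, (map_poly i A).[w] = 0 -> A = 0.
Hypothesis w_alg : forall x : K,
  exists2 F : {poly {poly k}}, F != 0 & eval2 i F w x = 0.

Definition k_subalgebra (V : K -> Prop) : Prop :=
  [/\ forall c, V (i c), forall x y, V x -> V y -> V (x + y)
    & forall x y, V x -> V y -> V (x * y)].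

(* A maximal such V is a valuation ring of K with residue field k, whose      *)
(* centre on C is the point sought.                                           *)
Definition w_nonunit (V : K -> Prop) : Prop :=
  [/\ k_subalgebra V, V w & ~ V w^-1].

Definition w_polys (z : K) : Prop := exists A : {poly k}, z = (map_poly i A).[w].

Lemma w_polys_nonunit : w_nonunit w_polys.
Proof.
split; first split.
- by move=> c; exists c%:P; rewrite map_polyC hornerC.
- by move=> x y [A ->] [B ->]; exists (A + B); rewrite rmorphD hornerD.
- by move=> x y [A ->] [B ->]; exists (A * B); rewrite rmorphM hornerM.
- by exists 'X; rewrite map_polyX hornerX.
case=> A wA; have /w_transc/(congr1 (horner^~ 0)) :
    (map_poly i ('X * A - 1)).[w] = 0.
  by rewrite rmorphB rmorphM /= map_polyX rmorph1 !hornerE -wA mulfV ?subrr.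
by rewrite !hornerE /= ?mul0r ?sub0r => /eqP; rewrite oppr_eq0 oner_eq0.
Qed.

Lemma maximal_w_nonunit : exists2 V, w_nonunit V &
  forall W, w_nonunit W -> (forall x, V x -> W x) -> forall x, W x -> V x.
Proof.
pose Q (V : classical_sets.set K) := (forall x, ~ V x) \/ w_nonunit V.
have [F QF totF|V [QV maxV]] := @classical_sets.Zorn_bigcup K Q.
  have [[X [FX neX]]|noX] := boolp.EM (exists X, F X /\ w_nonunit X); last first.
    left=> x [X FX Xx]; have [X0|wX] := QF X FX; first exact: X0 Xx.
    by case: noX; exists X.
  have wF Y y : F Y -> Y y -> w_nonunit Y by case/QF=> // Y0 /Y0.
  have join Y Z y z : F Y -> F Z -> Y y -> Z z -> exists2 T, F T & T y /\ T z.
    move=> FY FZ Yy Zz; have [YZ|ZY] := totF _ _ FY FZ.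
      by exists Z => //; split=> //; apply: YZ.
    by exists Y => //; split=> //; apply: ZY.
  case: neX => -[Xc _ _] Xw _.
  right; split; first split.
  - by move=> c; exists X.
  - move=> x y [Y FY Yx] [Z FZ Zy].
    have [T FT [Tx Ty]] := join _ _ _ _ FY FZ Yx Zy.
    by have [[_ TD _] _ _] := wF _ _ FT Tx; exists T => //; apply: TD.
  - move=> x y [Y FY Yx] [Z FZ Zy].
    have [T FT [Tx Ty]] := join _ _ _ _ FY FZ Yx Zy.
    by have [[_ _ TM] _ _] := wF _ _ FT Tx; exists T => //; apply: TM.
  - by exists X.
  - by case=> Y FY Yw; have [_ _] := wF _ _ FY Yw.
have wV : w_nonunit V.
  case: QV => // V0; case: (maxV w_polys); last by right; apply: w_polys_nonunit.
  split=> [x /V0 //|sub]; case: w_polys_nonunit => -[c _ _] _ _.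
  exact: V0 (sub _ (c 0)).
exists V => // W wW sVW x Wx; apply: boolp.contrapT => nVx.
by case: (maxV W); [split=> // sWV; apply: nVx; apply: sWV | right].
Qed.

Variable V : K -> Prop.
Hypothesis wV : w_nonunit V.
Hypothesis maxV :
  forall W, w_nonunit W -> (forall x, V x -> W x) -> forall x, W x -> V x.

Let Vc c : V (i c). Proof. by case: wV => -[]. Qed.
Let VD x y : V x -> V y -> V (x + y). Proof. by case: wV => -[_ + _] _ _; apply. Qed.
Let VM x y : V x -> V y -> V (x * y). Proof. by case: wV => -[_ _ +] _ _; apply. Qed.
Let V1 : V 1. Proof. by rewrite -(rmorph1 i). Qed.
Let V0 : V 0. Proof. by rewrite -(rmorph0 i). Qed.
Let VN x : V x -> V (- x).
Proof. by move=> Vx; rewrite -mulN1r -(rmorph1 i) -rmorphN; apply: VM. Qed.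
Let Vw : V w. Proof. by case: wV. Qed.
Let nVw : ~ V w^-1. Proof. by case: wV. Qed.
Let VX x n : V x -> V (x ^+ n).
Proof. by move=> Vx; elim: n => [|n IH]; rewrite ?expr0 // exprS; apply: VM. Qed.
Let Vsum (I : Type) (s : seq I) (f : I -> K) :
  (forall j, V (f j)) -> V (\sum_(j <- s) f j).
Proof. by move=> Vf; elim/big_rec: _ => // j x _; apply: VD. Qed.
Let Vprod (I : Type) (s : seq I) (f : I -> K) :
  (forall j, V (f j)) -> V (\prod_(j <- s) f j).
Proof. by move=> Vf; elim/big_rec: _ => // j x _; apply: VM. Qed.

Definition powers_span (n : nat) (x z : K) : Prop :=
  exists2 f : nat -> K, (forall j, V (f j)) & z = \sum_(j < n) f j * x ^+ j.

Lemma powers_span_add n x y z :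
  powers_span n x y -> powers_span n x z -> powers_span n x (y + z).
Proof.
move=> [f Vf ->] [g Vg ->]; exists (fun j => f j + g j) => [j|]; first exact: VD.
by rewrite -big_split; apply: eq_bigr => j _; rewrite mulrDl.
Qed.

Lemma powers_span_scale n x v z :
  V v -> powers_span n x z -> powers_span n x (v * z).
Proof.
move=> Vv [f Vf ->]; exists (fun j => v * f j) => [j|]; first exact: VM.
by rewrite mulr_sumr; apply: eq_bigr => j _; rewrite mulrA.
Qed.

Lemma powers_span_exp n x j : (j < n)%N -> powers_span n x (x ^+ j).
Proof.
move=> ltjn; exists (fun l => (l == j)%:R) => [l|]; first by case: eqP.
rewrite (bigD1 (Ordinal ltjn)) //= eqxx mul1r big1 ?addr0 // => l.
by rewrite -val_eqE /= => /negPf->; rewrite mul0r.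
Qed.

(** The ring V[x] is strictly larger than V, so by maximality it is not admissible; the only
    condition that can fail is that w^-1 stays outside. *)
Lemma adjoin_inv x : ~ V x -> exists n, powers_span n x w^-1.
Proof.
move=> nVx; pose W z := exists2 p : {poly K}, forall j, V p`_j & z = p.[x].
have [[p Vp wE]|nW] := boolp.EM (W w^-1).
  by exists (size p), (fun j => p`_j); rewrite // wE horner_coef.
have sVW z : V z -> W z.
  move=> Vz; exists z%:P; last by rewrite hornerC.
  by move=> j; rewrite coefC; case: eqP.
case: nVx; apply: (maxV _ sVW); last first.
  by exists 'X; [move=> j; rewrite coefX; case: eqP | rewrite hornerX].
split; [split | exact: sVW | exact: nW].
- by move=> c; apply: sVW.
- move=> y z [p Vp ->] [q Vq ->]; exists (p + q); last by rewrite hornerD.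
  by move=> j; rewrite coefD; apply: VD.
- move=> y z [p Vp ->] [q Vq ->]; exists (p * q); last by rewrite hornerM.
  by move=> j; rewrite coefM; apply: Vsum => l; apply: VM.
Qed.

(** Put y = 1 - w v. If y^-1 were not in V, then w^-1 would be a combination of powers of y^-1 of
    exponent below some n, so y^n w^-1 would lie in V. As y^n is 1 modulo w V, w^-1 itself would lie
    in V. *)
Lemma V_inv_1subw v : V v -> V (1 - w * v)^-1.
Proof.
move=> Vv; set y := 1 - _.
have y0 : y != 0.
  apply: contra_not_neq nVw => /eqP; rewrite subr_eq0 => /eqP wv.
  suff -> : w^-1 = v by [].
  by apply: (mulfI w_neq0); rewrite mulfV.
have Vy : V y by apply: VD => //; apply: VN; apply: VM.
apply: boolp.contrapT => /adjoin_inv[n [f Vf wE]].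
have [v' Vv' yE] : exists2 v', V v' & y ^+ n = 1 - w * v'.
  elim: (n) => [|l [v' Vv' IH]]; first by exists 0; rewrite // mulr0 subr0 expr0.
  exists (v + v' - v * w * v'); last by rewrite exprS IH /y; ring.
  by do ?[apply: VD | apply: VN | apply: VM].
apply: nVw; suff -> : w^-1 = v' + y ^+ n * w^-1.
  apply: VD => //; rewrite wE mulr_sumr; apply: Vsum => j.
  have -> : y ^+ n = y ^+ j * y ^+ (n - j).
    by rewrite -exprD subnKC // ltnW.
  suff -> : y ^+ j * y ^+ (n - j) * (f j * y^-1 ^+ j) = f j * y ^+ (n - j).
    by apply: VM => //; apply: VX.
  rewrite mulrCA -mulrA [_ * y^-1 ^+ j]mulrC [y ^+ j * _]mulrA exprVn.
  rewrite mulfV ?mul1r //.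
  exact: expf_neq0.
by rewrite yE mulrBl mul1r mulrAC mulfV // mul1r addrC subrK.
Qed.

(* Descent on the degrees: the relation in x^-1 expresses x^n by lower powers *)
(* of x, because 1 - w * v is a unit of V.                                    *)
Lemma powers_span_lower n m (x : K) : x != 0 -> (m <= n)%N ->
  powers_span n.+1 x w^-1 -> powers_span m.+1 x^-1 w^-1 -> powers_span n x w^-1.
Proof.
move=> x0 lemn [f Vf wf] [g Vg wg].
have xn : powers_span n x (x ^+ n).
  have g0 : 1 - w * g 0 != 0.
    apply: contra_not_neq nVw => /eqP; rewrite subr_eq0 => /eqP wv.
    suff -> : w^-1 = g 0 by [].
    by apply: (mulfI w_neq0); rewrite mulfV.
  have := wg; rewrite big_ord_recl expr0 mulr1 => /eqP.
  rewrite addrC -subr_eq => /eqP/(congr1 (fun z => w * z * x ^+ n)).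
  rewrite mulrBr mulfV // => /(congr1 ( *%R (1 - w * g 0)^-1)).
  rewrite mulKf // => ->.
  apply: powers_span_scale; first exact: V_inv_1subw.
  rewrite -mulrA mulr_suml; apply: powers_span_scale => //.
  elim/big_ind: _ => [|y z|j _].
  - by exists (fun=> 0) => //; rewrite big1 // => j _; rewrite mul0r.
  - exact: powers_span_add.
  rewrite -mulrA; apply: powers_span_scale => //.
  have ltjn : (j < n)%N := leq_trans (ltn_ord j) lemn.
  have -> : x^-1 ^+ j.+1 * x ^+ n = x ^+ (n - j.+1).
    have xj0 : x ^+ j.+1 != 0 by apply: expf_neq0.
    by apply: (mulfI xj0); rewrite exprVn mulVKf // -exprD subnKC.
  by apply: powers_span_exp; rewrite ltn_subrL (leq_ltn_trans _ ltjn).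
rewrite wf big_ord_recr /=; apply: powers_span_add; last exact: powers_span_scale.
by exists f.
Qed.

Lemma V_total (x : K) : x != 0 -> V x \/ V x^-1.
Proof.
move=> x0; apply: boolp.contrapT => /boolp.not_orP[nVx nVx'].
have [[n wn] [m wm]] := (adjoin_inv nVx, adjoin_inv nVx').
have span0 y : ~ powers_span 0 y w^-1.
  by case=> f _ /eqP; rewrite big_ord0 invr_eq0 (negPf w_neq0).
(* Induction on a bound for n + m, with x generalised so that x and x^-1 may be exchanged: the
   longer of the two expressions of w^-1 gets shorter, and an empty one would give w^-1 = 0. *)
elim: {n m}(n + m)%N {-2}n {-2}m (leqnn (n + m)) x x0 wn wm {nVx nVx'}
  => [|N IH] [|n] [|m] lenm x x0 wn wm //; do 1?[exact: span0 wn | exact: span0 wm].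
have [lemn|/ltnW lenm'] := leqP m n.
  apply: (IH n m.+1 _ x x0 (powers_span_lower x0 lemn wn wm) wm).
  by move: lenm; lia.
have xV0 : x^-1 != 0 by rewrite invr_eq0.
rewrite -[x]invrK in wn.
apply: (IH m n.+1) (powers_span_lower xV0 lenm' wm wn) wn => //.
by move: lenm; lia.
Qed.

(** The nonunits of V. Zero is allowed explicitly because 0^-1 = 0 lies in V. *)
Definition V_max (x : K) : Prop := V x /\ (V x^-1 -> x = 0).

Lemma V_max_mul v x : V v -> V_max x -> V_max (v * x).
Proof.
move=> Vv [Vx x0]; split=> [|Vvx]; first exact: VM.
apply/eqP/idPn => vx0; have [v0 x0'] : v != 0 /\ x != 0.
  by apply/andP; rewrite -negb_or -mulf_eq0.
move/eqP: x0'; apply; apply: x0.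
have -> : x^-1 = v * (v * x)^-1 by rewrite invfM mulVKf.
exact: VM.
Qed.

Lemma V_max_add x y : V_max x -> V_max y -> V_max (x + y).
Proof.
have aux u v : v != 0 -> V_max u -> V_max v -> V (u / v) -> V_max (u + v).
  move=> v0 mu mv Vuv; have -> : u + v = (u / v + 1) * v.
    by rewrite mulrDl mul1r divfK.
  by apply: V_max_mul => //; apply: VD.
move=> mx my; have [->|x0] := eqVneq x 0; first by rewrite add0r.
have [->|y0] := eqVneq y 0; first by rewrite addr0.
have [|Vxy|] := @V_total (x / y); first by rewrite mulf_neq0 ?invr_eq0.
  exact: aux.
by rewrite invf_div => Vyx; rewrite addrC; apply: aux.
Qed.

Lemma V_max_prime x y : V x -> V y -> V_max (x * y) -> V_max x \/ V_max y.
Proof.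
move=> Vx Vy [_ xy0].
have [mx|nmx] := boolp.EM (V_max x); [by left | right; split=> // Vy'].
apply/eqP/idPn => y0; apply: nmx; split=> // Vx'.
have : x * y = 0 by apply: xy0; rewrite invfM; apply: VM.
by move/eqP; rewrite mulf_eq0 (negPf y0) orbF => /eqP.
Qed.

Lemma V_max_const c : V_max (i c) -> c = 0.
Proof.
case=> _ c0; apply/eqP; rewrite -(fmorph_eq0 i); apply/eqP/c0.
by rewrite -fmorphV.
Qed.

Lemma V_max_w : V_max w. Proof. by split=> // /nVw. Qed.

(** If all coefficients of a relation vanish at w = 0, the relation can be divided by w. This stops
    because the size of a fixed nonzero coefficient drops each time. *)
Lemma alg_relation_special (x : K) : exists2 F : {poly {poly k}},
  eval2 i F w x = 0 & map_poly (horner_eval 0) F != 0.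
Proof.
have [F F0 Fx] := w_alg x.
have [j Fj] : exists j, F`_j != 0.
  by exists (size F).-1; rewrite -/(lead_coef F) lead_coef_eq0.
elim: {F F0}(size F`_j) {-2}F (leqnn (size F`_j)) Fx Fj => [|N IH] F leFN Fx Fj.
  by rewrite -size_poly_gt0 lt0n -leqn0 leFN in Fj.
have [F0|] := eqVneq (map_poly (horner_eval 0) F) 0; last by exists F.
have FE l : F`_l = 'X * (F`_l %/ 'X).
  rewrite mulrC divpK // -['X]subr0 -polyC0 dvdp_XsubCl /root.
  by rewrite -/(horner_eval 0 _) -(coef_map (horner_eval 0)) /= F0 coef0.
pose F' := \poly_(l < size F) (F`_l %/ 'X).
have F'E l : F'`_l = F`_l %/ 'X.
  by rewrite coef_poly; case: ltnP => // /(nth_default 0)->; rewrite div0p.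
have FF' : F = 'X%:P * F' by apply/polyP => l; rewrite coefCM F'E.
have F'j : F'`_j != 0.
  by apply: contraNneq Fj => F'j; rewrite FE -F'E F'j mulr0.
apply: (IH F') => //.
  by rewrite -ltnS (leq_trans _ leFN) // [in X in (_ < X)%N]FE -F'E mulrC size_mulX.
apply/eqP; move/eqP: Fx; rewrite FF' /eval2.
have -> : map_poly (fun A : {poly k} => (map_poly i A).[w]) ('X%:P * F') =
          w%:P * map_poly (fun A : {poly k} => (map_poly i A).[w]) F'.
  apply/polyP=> l; rewrite coefCM !coef_map_id0 ?rmorph0 ?horner0 //.
  by rewrite coefCM rmorphM /= map_polyX hornerM hornerX.
by rewrite hornerM hornerC mulf_eq0 (negPf w_neq0).
Qed.

Definition V_residue (x : K) (c : k) : Prop := V_max (x - i c).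

(** Setting w = 0 in a relation satisfied by x changes its value at x by an element of w V, so a
    nonzero polynomial f over k has f(x) in [V_max]. Since k is algebraically closed, f splits, and
    primality of [V_max] puts some x - c in it. *)
Lemma V_residue_exists x : V x -> exists c, V_residue x c.
Proof.
move=> Vx; have [F Fx] := alg_relation_special x.
set f := map_poly _ F => f0.
have VA (A : {poly k}) : V (map_poly i A).[w].
  rewrite horner_coef; apply: Vsum => j; rewrite coef_map /=.
  exact: VM (Vc _) (VX _ _).
have fx : V_max (map_poly i f).[x].
  rewrite -[X in V_max X]subr0 -{1}Fx /eval2.
  pose F1 := map_poly i f - map_poly (fun A : {poly k} => (map_poly i A).[w]) F.
  rewrite -hornerN -hornerD -/F1 horner_coef.
  elim/big_ind: _ => [||j _]; [by split | exact: V_max_add |].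
  rewrite mulrC; apply: V_max_mul; first exact: VX.
  rewrite coefB coef_map /= coef_map_id0 /horner_eval ?horner0 //.
  rewrite coef_map_id0 ?rmorph0 ?horner0 //.
  elim/poly_ind: F`_j => [|A c _]; first by rewrite !rmorph0 !horner0 rmorph0 subrr; split.
  rewrite rmorphD rmorphM /= map_polyX map_polyC !hornerE /= ?mulr0 ?add0r.
  rewrite opprD addrCA subrr addr0.
  rewrite -mulNr; apply: V_max_mul V_max_w; apply: VN; exact: VA.
have [r fE] := closed_field_poly_normal f.
move: fx; rewrite fE map_polyZ hornerZ rmorph_prod horner_prod => /V_max_prime[].
- exact: Vc.
- apply: Vprod => c; rewrite rmorphB /= map_polyX map_polyC !hornerE.
  exact: VD Vx (VN (Vc _)).
- by move=> /V_max_const/eqP; rewrite lead_coef_eq0 (negPf f0).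
elim: r {fE} => [|c r IH].
  by rewrite big_nil -(rmorph1 i) => /V_max_const/eqP; rewrite oner_eq0.
have Vxc b : V (x - i b) := VD Vx (VN (Vc b)).
rewrite big_cons rmorphB /= map_polyX map_polyC !hornerE => /V_max_prime[].
- exact: Vxc.
- by apply: Vprod => b; rewrite rmorphB /= map_polyX map_polyC !hornerE; apply: Vxc.
- by exists c.
- exact: IH.
Qed.

Lemma V_residue_const c : V_residue (i c) c.
Proof. by rewrite /V_residue subrr; split. Qed.

Lemma V_residue_in x c : V_residue x c -> V x.
Proof. by case=> Vx _; rewrite -[x](subrK (i c)); apply: VD. Qed.

Lemma V_residue_add x c y d :
  V_residue x c -> V_residue y d -> V_residue (x + y) (c + d).
Proof. by move=> xc yd; rewrite /V_residue rmorphD opprD addrACA; apply: V_max_add. Qed.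

Lemma V_residue_mul x c y d :
  V_residue x c -> V_residue y d -> V_residue (x * y) (c * d).
Proof.
move=> xc yd; rewrite /V_residue rmorphM.
have -> : x * y - i c * i d = x * (y - i d) + i d * (x - i c) by ring.
by apply: V_max_add; apply: V_max_mul => //; apply: V_residue_in xc.
Qed.

Lemma V_residue_exp x c n : V_residue x c -> V_residue (x ^+ n) (c ^+ n).
Proof.
move=> xc; elim: n => [|n IH]; last by rewrite !exprS; apply: V_residue_mul.
by rewrite !expr0 -(rmorph1 i); apply: V_residue_const.
Qed.

Lemma V_residue_mmap N (g : 'I_N -> K) (P : 'I_N -> k) (F : {mpoly k[N]}) :
  (forall l, V_residue (g l) (P l)) -> V_residue (mmap i g F) F.@[P].
Proof.
move=> gP; rewrite /meval /mmap.
elim/big_ind2: _ => [|? ? ? ?|m _].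
- by rewrite -[X in V_residue X](rmorph0 i); apply: V_residue_const.
- exact: V_residue_add.
apply: V_residue_mul; first exact: V_residue_const.
rewrite /mmap1; elim/big_ind2: _ => [|? ? ? ?|l _].
- by rewrite -[X in V_residue X](rmorph1 i); apply: V_residue_const.
- exact: V_residue_mul.
- exact: V_residue_exp.
Qed.

Lemma V_residue_neq0 x c : V_residue x c -> c != 0 -> x != 0 /\ V x^-1.
Proof.
move=> xc c0; have Vx := V_residue_in xc.
have nmx : ~ V_max x.
  move=> mx; move/eqP: c0; apply; apply: V_max_const.
  have -> : i c = x + (- 1) * (x - i c) by ring.
  by apply: V_max_add mx _; apply: V_max_mul => //; apply: VN.
have x0 : x != 0 by apply/eqP=> x0; apply: nmx; rewrite x0; split.
by split=> //; apply: boolp.contrapT => nVx; apply: nmx; split.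
Qed.

(** The index j is one of least valuation, found by scanning the finite list of indices and
    replacing the pivot when a quotient leaves V. *)
Lemma V_normalise N (g : 'I_N -> K) : (exists j, g j != 0) ->
  exists2 j, g j != 0 & forall l, V (g l / g j).
Proof.
case=> j0 gj0.
suff [j gj Vj] : exists2 j, g j != 0 & forall l, l \in enum 'I_N -> V (g l / g j).
  by exists j => // l; apply: Vj; rewrite mem_enum.
elim: (enum _) => [|a s [j gj Vj]]; first by exists j0.
have [Va|nVa] := boolp.EM (V (g a / g j)).
  by exists j => // l; rewrite inE => /predU1P[->|/Vj].
have ga : g a != 0 by apply: contra_not_neq nVa => ->; rewrite mul0r.
have Vja : V (g j / g a).
  have [|//|] := @V_total (g a / g j); first by rewrite mulf_neq0 ?invr_eq0.
  by rewrite invf_div.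
exists a => // l; rewrite inE => /predU1P[->|/Vj Vl]; first by rewrite mulfV.
have -> : g l / g a = (g l / g j) * (g j / g a) by rewrite mulrA divfK.
exact: VM.
Qed.

End Place.

Lemma mmap_homog_scale (k K : fieldType) (i : {rmorphism k -> K}) N
    (g : 'I_N -> K) (a : K) d (F : {mpoly k[N]}) :
  F \is d.-homog -> mmap i (fun l => g l * a) F = a ^+ d * mmap i g F.
Proof.
move=> /dhomogP hF; rewrite /mmap mulr_sumr; apply: eq_big_seq => m /hF mE.
have {}mE : d = (\sum_l m l)%N by rewrite -mdegE -mE.
rewrite mulrCA; congr (_ * _); rewrite /mmap1 mE -prodrXr -big_split /=.
by apply: eq_bigr => l _; rewrite exprMn mulrC.
Qed.

(** The valuative criterion of properness: divide the generic point by a coordinate of least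
    valuation and take residues to get P. The local ring at P is contained in V, hence does not
    contain w^-1; as it is a discrete valuation ring, w has positive order at P. *)
Lemma center_exists (k : closedFieldType) (K : fieldType)
    (i : {rmorphism k -> K}) (C : proj_variety i) (w : K) :
  smooth_curve C -> w != 0 ->
  (forall A : {poly k}, (map_poly i A).[w] = 0 -> A = 0) ->
  (forall x : K, exists2 F : {poly {poly k}}, F != 0 & eval2 i F w x = 0) ->
  exists2 R : coords C, on_variety R & in_max_ideal R w.
Proof.
move=> smoothC w0 w_transc w_alg.
have [V wV maxV] := maximal_w_nonunit w0 w_transc.
have [j gj Vj] := V_normalise w0 wV maxV (@pv_gen_neq0 _ _ _ C).
pose g' l := @pv_gen _ _ _ C l / @pv_gen _ _ _ C j.
have g'E d (F : {mpoly k[(pv_dim C).+1]}) : F \is d.-homog ->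
    mmap i g' F = (@pv_gen _ _ _ C j)^-1 ^+ d * mmap i (@pv_gen _ _ _ C) F.
  exact: mmap_homog_scale.
have [P resP] := fin_all_exists (fun l => V_residue_exists w0 w_alg wV maxV (Vj l)).
have onP : on_variety P.
  split=> [|d F hF F0].
    exists j; apply/eqP => Pj; have := resP j; rewrite mulfV // Pj /V_residue.
    by rewrite -(rmorph1 i) -rmorphB => /(V_max_const wV)/eqP; rewrite subr0 oner_eq0.
  apply/eqP/idPn => FP.
  have := V_residue_neq0 w0 wV maxV (V_residue_mmap w0 wV maxV F resP) FP.
  by rewrite -/g' (g'E d) // F0 mulr0 eqxx => -[].
exists P => //.
have nO : ~ in_local_ring P w^-1.
  move=> [d [F [G [hF hG GP Gg wE]]]].
  have resG := V_residue_mmap w0 wV maxV G resP.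
  have [g'G Vg'G] := V_residue_neq0 w0 wV maxV resG GP.
  have Vg'F := V_residue_in wV (V_residue_mmap w0 wV maxV F resP).
  case: (wV) => -[_ _ VM] _; apply; rewrite wE.
  have -> : mmap i (@pv_gen _ _ _ C) F / mmap i (@pv_gen _ _ _ C) G =
            mmap i g' F / mmap i g' G.
    by rewrite !(g'E d) // -mulf_div divff ?mul1r // expf_neq0 // invr_eq0.
  exact: VM.
have [pi [pi0 mpi piE]] := smoothC P onP.
have [a [v [uv wE]]] := piE w w0.
have [a0|a0] := ltP 0 a.
  by rewrite wE; apply: max_mulr => //; [apply: unit_in_local | apply: max_expz].
case: nO; rewrite wE invfM invr_expz; apply: local_mul => //.
  by apply: unit_in_local; apply: unit_inv.
move: a0; rewrite -oppr_ge0 le_eqVlt => /predU1P[<-|a0].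
  by rewrite expr0z -(rmorph1 i); apply: local_const.
by apply: max_in_local => //; apply: max_expz.
Qed.

(** * Subfields generated by one function *)

Lemma fraction_div (R : idomainType) (f : {fraction R}) :
  exists n d : R, d != 0 /\ f = tofrac n / tofrac d.
Proof.
have /= fE := generic_quotient.reprK f.
move: (generic_quotient.repr f) fE => r <-.
have d0 := denom_ratioP r.
exists \n_r, \d_r; split=> //.
apply: (mulIf (x := tofrac \d_r)); first by rewrite tofrac_eq0.
rewrite divfK ?tofrac_eq0 //; unlock FracField.tofrac.
rewrite -[LHS]FracField.pi_mul; apply/generic_quotient.eqmodP.
rewrite /= FracField.equivfE.
by rewrite /FracField.mulf !numden_Ratio ?oner_eq0 ?mulf_neq0 ?oner_eq0 ?mulr1 // mulrC.
Qed.

Section SimpleExtension.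

Variables (k K : fieldType) (i : {rmorphism k -> K}).
Local Notation ext := (in_simple_ext i).

Definition poly_at (x : K) : {rmorphism {poly k} -> K} :=
  (horner_eval x \o map_poly i).

Lemma eval2E F x y : eval2 i F x y = (map_poly (poly_at x) F).[y].
Proof. by []. Qed.

Lemma simple_ext_const u c : ext u (i c).
Proof.
exists c%:P, 1; rewrite rmorph1 hornerC oner_eq0; split=> //.
by rewrite map_polyC hornerC divr1.
Qed.

Lemma simple_ext_gen u : ext u u.
Proof.
exists 'X, 1; rewrite rmorph1 hornerC oner_eq0; split=> //.
by rewrite map_polyX hornerX divr1.
Qed.

Lemma simple_ext_add u x y : ext u x -> ext u y -> ext u (x + y).
Proof.
move=> [A [B [B0 ->]]] [A' [B' [B'0 ->]]]; exists (A * B' + A' * B), (B * B').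
rewrite rmorphD !rmorphM hornerD !hornerM mulf_neq0 //; split=> //.
by rewrite addf_div.
Qed.

Lemma simple_ext_mul u x y : ext u x -> ext u y -> ext u (x * y).
Proof.
move=> [A [B [B0 ->]]] [A' [B' [B'0 ->]]]; exists (A * A'), (B * B').
by rewrite !rmorphM !hornerM mulf_neq0 // mulf_div.
Qed.

Lemma simple_ext_opp u x : ext u x -> ext u (- x).
Proof.
rewrite -mulN1r -(rmorph1 i) -rmorphN.
exact: simple_ext_mul (simple_ext_const _ _).
Qed.

Lemma simple_ext_inv u x : ext u x -> ext u x^-1.
Proof.
move=> [A [B [B0 ->]]]; have [A0|A0] := eqVneq (map_poly i A).[u] 0.
  by rewrite A0 mul0r invr0 -(rmorph0 i); apply: simple_ext_const.
by exists B, A; rewrite invf_div.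
Qed.

Lemma simple_ext_horner u x (A : {poly k}) : ext u x -> ext u (map_poly i A).[x].
Proof.
move=> ux; elim/poly_ind: A => [|A c IH].
  by rewrite rmorph0 horner0 -(rmorph0 i); apply: simple_ext_const.
rewrite rmorphD rmorphM /= map_polyX map_polyC !hornerE.
by apply: simple_ext_add (simple_ext_const _ _); apply: simple_ext_mul.
Qed.

Lemma simple_ext_trans u x z : ext u x -> ext x z -> ext u z.
Proof.
move=> ux [A [B [_ ->]]]; apply: simple_ext_mul; first exact: simple_ext_horner.
by apply: simple_ext_inv; apply: simple_ext_horner.
Qed.

Lemma common_denominator u (p : {poly K}) : (forall j, ext u p`_j) ->
  exists (D : {poly k}) (F : {poly {poly k}}),
    poly_at u D != 0 /\ map_poly (poly_at u) F = poly_at u D *: p.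
Proof.
elim/poly_ind: p => [|p c IH] up.
  by exists 1, 0; rewrite rmorph1 oner_eq0 rmorph0 scaler0.
have [|D [F [D0 FE]]] := IH.
  by move=> j; have := up j.+1; rewrite coefD coefMX coefC /= addr0.
have [A [B [B0 cE]]] : ext u c by have := up 0; rewrite coefD coefMX coefC add0r.
exists (D * B), (B%:P * F * 'X + (A * D)%:P).
rewrite rmorphM mulf_neq0 //; split=> //.
rewrite rmorphD !rmorphM /= map_polyX map_polyC FE map_polyC /= cE scalerDr.
rewrite map_polyC /= /horner_eval; congr (_ + _).
  by rewrite mul_polyC scalerA scalerAl [_.[u] * _]mulrC.
by rewrite -polyCM -mul_polyC -polyCM; congr (_%:P); field.
Qed.

End SimpleExtension.

(** * Generators of k(t) inside K *)

Section FunctionField.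

Variables (k : closedFieldType) (K : splittingFieldType {fraction {poly k}}).
Local Notation i := (constK K).
Local Notation t := (tK K).
Local Notation ext := (in_simple_ext i).

Lemma horner_tK (A : {poly k}) : (map_poly i A).[t] = in_alg K (tofrac A).
Proof.
elim/poly_ind: A => [|A c IH]; first by rewrite !rmorph0 horner0.
rewrite rmorphD rmorphM /= map_polyX map_polyC !hornerE IH.
by rewrite tofracD tofracM scalerDl -scalerA -scalerAl mul1r.
Qed.

Lemma tK_transc (A : {poly k}) : (map_poly i A).[t] = 0 -> A = 0.
Proof.
rewrite horner_tK => /eqP; rewrite fmorph_eq0 => A0.
by apply/eqP; rewrite -tofrac_eq0.
Qed.

Lemma simple_ext_tKP z : ext t z <-> z \in 1%VS.
Proof.
split=> [[A [B [_ ->]]]|/vlineP[f ->]].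
  by rewrite !horner_tK -fmorph_div; apply/vlineP; exists (tofrac A / tofrac B).
have [n [d [d0 ->]]] := fraction_div f.
exists n, d; rewrite !horner_tK fmorph_eq0 tofrac_eq0; split=> //.
by rewrite -fmorph_div.
Qed.

Definition rational_generator (u : K) : Prop := forall z, ext u z <-> ext t z.

Variable u : K.
Hypothesis genu : rational_generator u.

Lemma rational_generatorP z : ext u z <-> z \in 1%VS.
Proof. by rewrite -simple_ext_tKP. Qed.

Lemma rational_generator_const c : u <> i c.
Proof.
move=> uc; have [A [B [_]]] : ext u t by apply/genu; apply: simple_ext_gen.
rewrite uc !horner_map -fmorph_div; set b := _ / _ => tb.
have /tK_transc : (map_poly i ('X - b%:P)).[t] = 0.
  rewrite rmorphB /= map_polyX map_polyC !hornerE.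
  by apply/eqP; rewrite subr_eq0; apply/eqP.
by apply/eqP; rewrite polyXsubC_eq0.
Qed.

(** Over an algebraically closed field it suffices that u is not constant, since A splits into
    linear factors. *)
Lemma rational_generator_transc (A : {poly k}) : (map_poly i A).[u] = 0 -> A = 0.
Proof.
move=> Au; apply/eqP/idPn => A0; have [r AE] := closed_field_poly_normal A.
move/eqP: Au; rewrite AE map_polyZ hornerZ mulf_eq0 fmorph_eq0 lead_coef_eq0.
rewrite (negPf A0) /=; elim: r {AE} => [|c r IH].
  by rewrite big_nil rmorph1 hornerC oner_eq0.
rewrite big_cons rmorphM hornerM mulf_eq0 => /orP[|//].
rewrite rmorphB /= map_polyX map_polyC !hornerE subr_eq0 => /eqP.
exact: rational_generator_const.
Qed.

Lemma rational_generator_neq0 : u != 0.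
Proof.
by apply/eqP => u0; apply: (@rational_generator_const 0); rewrite rmorph0.
Qed.

Lemma rational_generator_alg x :
  exists2 F : {poly {poly k}}, F != 0 & eval2 i F u x = 0.
Proof.
have pu j : ext u (minPoly 1 x)`_j.
  by apply/rational_generatorP; apply/polyOverP/minPolyOver.
have [D [F [D0 FE]]] := common_denominator pu.
exists F; last by rewrite eval2E FE hornerZ minPolyxx mulr0.
apply: contraNneq D0 => F0; move/eqP: FE; rewrite F0 rmorph0 eq_sym scaler_eq0.
by rewrite (negPf (monic_neq0 (monic_minPoly _ _))) orbF.
Qed.

End FunctionField.

Lemma rational_generatorI (k : closedFieldType)
    (K : splittingFieldType {fraction {poly k}}) (u : K) :
  in_simple_ext (constK K) (tK K) u -> in_simple_ext (constK K) u (tK K) ->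
  rational_generator u.
Proof. by move=> tu ut z; split; apply: simple_ext_trans. Qed.

Lemma param_generator (k : closedFieldType)
    (K : splittingFieldType {fraction {poly k}}) (q : option k) :
  rational_generator (param K q).
Proof.
case: q => [a|] /=; apply: rational_generatorI.
- apply: simple_ext_add; first exact: simple_ext_gen.
  by apply: simple_ext_opp; apply: simple_ext_const.
- rewrite -{2}[tK K](subrK (constK K a)).
  by apply: simple_ext_add; [apply: simple_ext_gen | apply: simple_ext_const].
- by apply: simple_ext_inv; apply: simple_ext_gen.
- by rewrite -{2}[tK K]invrK; apply: simple_ext_inv; apply: simple_ext_gen.
Qed.

Lemma center_over (k : closedFieldType)
    (K : splittingFieldType {fraction {poly k}}) (C : proj_variety (constK K))
    (q : option k) : smooth_curve C ->
  exists R : coords C, lies_above R q.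
Proof.
move=> smoothC; have gq := @param_generator k K q.
have [||R onR mR] := @center_exists _ _ (constK K) C (param K q) smoothC
  (rational_generator_neq0 gq).
- exact: rational_generator_transc.
- exact: rational_generator_alg.
by exists R.
Qed.

(** * Orders at points of the curve *)

Section LocalOrder.

Variables (k K : fieldType) (i : {rmorphism k -> K}) (C : proj_variety i).
Variable R : coords C.
Hypothesis onR : on_variety R.

Lemma unit_exp_in_max (x w : K) (a : int) : x != 0 -> in_max_ideal R x ->
  is_local_unit R w -> in_max_ideal R (w * x ^ a) -> 0 < a.
Proof.
move=> x0 mx uw mwx; case: ltP => // a0; case: (max_not_unit onR _ uw).
have -> : w = x ^ (- a) * (w * x ^ a).
  by rewrite mulrCA -expfzDr // addNr expr0z mulr1.
apply: max_mulr => //; move: a0; rewrite -oppr_ge0 le_eqVlt => /predU1P[<-|a0].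
  by rewrite expr0z; apply/unit_in_local/unit1.
by apply: max_in_local => //; apply: max_expz.
Qed.

Lemma horner_local_zero (u : K) (b : k) (A : {poly k}) (m : nat) :
  in_max_ideal R (u - i b) -> ~~ root A b ->
  exists2 w, is_local_unit R w &
    (map_poly i (A * ('X - b%:P) ^+ m)).[u] = w * (u - i b) ^+ m.
Proof.
move=> ub Ab; exists (map_poly i A).[u].
  by apply/local_unit_value => //; exists A.[b] => //; apply: value_at_horner.
rewrite rmorphM rmorphXn hornerM horner_exp rmorphB /= map_polyX map_polyC.
by rewrite !hornerE.
Qed.

(** Taking out u^(deg A) leaves the reversed polynomial evaluated at u^-1; its value at R is the
    leading coefficient of A, so it is a unit. *)
Lemma horner_local_pole (u : K) (A : {poly k}) : u != 0 ->
  in_max_ideal R u^-1 -> A != 0 ->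
  exists2 w, is_local_unit R w &
    (map_poly i A).[u] = w * u^-1 ^ (- (size A).-1%:Z).
Proof.
move=> u0 mu A0; pose d := (size A).-1; have szA : size A = d.+1.
  by rewrite prednK // size_poly_gt0.
pose B := \poly_(j < d.+1) A`_(d - j).
exists (map_poly i B).[u^-1].
  apply/local_unit_value => //; exists B.[0]; last first.
    exact: value_at_horner onR _ _ _ ((in_max_value R _).1 mu).
  by rewrite horner_coef0 coef_poly subn0 -lead_coefE lead_coef_eq0.
rewrite -/d -exprz_inv invrK -exprnP.
rewrite (horner_coef_wide (n := d.+1)) ?size_map_poly ?szA //.
rewrite [X in _ = X * _](horner_coef_wide (n := d.+1)) ?size_map_poly ?size_poly //.
rewrite mulr_suml (reindex_inj rev_ord_inj); apply: eq_bigr => j _ /=.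
rewrite !coef_map /= coef_poly ltn_ord subSS -mulrA; congr (_ * _).
have uj : u ^+ j != 0 by apply: expf_neq0.
by apply: (mulfI uj); rewrite -exprD subnKC -1?ltnS // exprVn mulVKf.
Qed.

Lemma simple_ext_local (u y z : K) :
  (exists b, y = u - i b) \/ y = u^-1 -> y != 0 -> in_max_ideal R y ->
  in_simple_ext i u z -> z != 0 ->
  exists (a : int) w, is_local_unit R w /\ z = w * y ^ a.
Proof.
move=> yE y0 my [A [B [Bu ->]]] AB0.
have Au : (map_poly i A).[u] != 0 by apply: contraNneq AB0 => ->; rewrite mul0r.
have poly_case (D : {poly k}) : (map_poly i D).[u] != 0 ->
    exists (a : int) w, is_local_unit R w /\ (map_poly i D).[u] = w * y ^ a.
  move=> Du; have D0 : D != 0 by apply: contraNneq Du => ->; rewrite rmorph0 horner0.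
  case: yE => [[b yE]|yE].
    have [m [q]] := multiplicity_XsubC D b; rewrite D0 /= => qb ->.
    have mb : in_max_ideal R (u - i b) by rewrite -yE.
    have [w uw ->] := horner_local_zero m mb qb.
    by exists m%:Z, w; rewrite yE.
  have u0 : u != 0 by rewrite -invr_eq0 -yE.
  have mu : in_max_ideal R u^-1 by rewrite -yE.
  have [w uw ->] := horner_local_pole u0 mu D0.
  by exists (- (size D).-1%:Z), w; rewrite yE.
have [a [w [uw ->]]] := poly_case A Au; have [a' [w' [uw' ->]]] := poly_case B Bu.
exists (a - a'), (w / w'); split; first by apply: unit_mul => //; apply: unit_inv.
by rewrite expfzDr // -invr_expz invfM mulrACA.
Qed.

Lemma smooth_local_or_inv (z : K) : smooth_curve C -> z != 0 ->
  in_local_ring R z \/ in_max_ideal R z^-1.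
Proof.
move=> smoothC z0; have [pi [pi0 mpi piE]] := smoothC R onR.
have [a [w [uw zE]]] := piE z z0; have [a0|a0] := leP 0 a.
  left; rewrite zE; apply: local_mul => //; first exact: unit_in_local.
  move: a0; rewrite le_eqVlt => /predU1P[<-|a0].
    by rewrite expr0z; apply/unit_in_local/unit1.
  by apply: max_in_local => //; apply: max_expz.
right; rewrite zE invfM invr_expz; apply: max_mulr => //.
  by apply/unit_in_local/unit_inv.
by apply: max_expz; rewrite // oppr_gt0.
Qed.

End LocalOrder.

(** * Points of C over the line, and coordinates u with k(u) = k(t) *)

Section PointsOverLine.

Variables (k : closedFieldType) (K : splittingFieldType {fraction {poly k}}).
Local Notation i := (constK K).
Local Notation t := (tK K).
Variable C : proj_variety i.

Lemma param_neq0 q : param K q != 0.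
Proof. exact: rational_generator_neq0 (@param_generator k K q). Qed.

Lemma param_shape (q : option k) : (exists b, param K q = t - i b) \/ param K q = t^-1.
Proof. by case: q => [a|]; [left; exists a | right]. Qed.

Lemma lies_above_uniq (R : coords C) q q' :
  lies_above R q -> lies_above R q' -> q = q'.
Proof.
move=> [onR mq] [_]; case: q q' mq => [a|] [b|] //= ma mb.
- congr Some; apply/eqP; rewrite eq_sym -subr_eq0; apply/eqP/(max_const onR).
  rewrite rmorphB; have -> : i b - i a = (t - i a) + - (t - i b) by ring.
  by apply: max_add => //; apply: max_opp.
- case: (max_not_unit onR _ (unit1 onR)).
  rewrite -(mulfV (rational_generator_neq0 (@param_generator k K None))) /= invrK mulrC.
  apply: max_mulr => //; rewrite -[t](subrK (i a)).
  by apply: local_add => //; [apply: max_in_local | apply: local_const].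
- case: (max_not_unit onR _ (unit1 onR)).
  rewrite -(mulfV (rational_generator_neq0 (@param_generator k K None))) /= invrK mulrC.
  apply: max_mulr => //; rewrite -[t](subrK (i b)).
  by apply: local_add => //; [apply: max_in_local | apply: local_const].
Qed.

Variable u : K.
Hypothesis genu : rational_generator u.

(** Write [param K q] as A(u)/B(u). At every pole of u it is a unit times u^-1 to the power deg B -
    deg A, an exponent independent of the pole. It is positive at R, hence at R', which therefore
    also lies above q. *)
Lemma pole_uniq (R R' : coords C) q q' : lies_above R q -> lies_above R' q' ->
  in_max_ideal R u^-1 -> in_max_ideal R' u^-1 -> q = q'.
Proof.
move=> Rq [onR' mq'] mu mu'; apply: (lies_above_uniq (R := R')) => //.
have [onR mq] := Rq; split=> //; have u0 := rational_generator_neq0 genu.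
have [A [B [B0 qE]]] : in_simple_ext i u (param K q).
  by apply/genu/(@param_generator k K q); apply: simple_ext_gen.
have nz (D : {poly k}) : (map_poly i D).[u] != 0 -> D != 0.
  by apply: contraNneq => ->; rewrite rmorph0 horner0.
have A0 : A != 0.
  by apply: nz; apply: contraNneq (param_neq0 q) => A0; rewrite qE A0 mul0r.
have ordq (S : coords C) : on_variety S -> in_max_ideal S u^-1 ->
    exists2 w, is_local_unit S w &
      param K q = w * u^-1 ^ ((size B).-1%:Z - (size A).-1%:Z).
  move=> onS mS; have [w uw AE] := horner_local_pole onS u0 mS A0.
  have [w' uw' BE] := horner_local_pole onS u0 mS (nz B B0).
  exists (w / w'); first by apply: unit_mul => //; apply: unit_inv.
  by rewrite qE AE BE addrC expfzDr ?invr_eq0 // invfM invr_expz opprK mulrACA.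
have [w uw wE] := ordq R onR mu; have [w' uw' ->] := ordq R' onR' mu'.
apply: max_mulr => //; first exact: unit_in_local.
apply: max_expz => //; apply: (unit_exp_in_max onR _ mu uw); rewrite -?wE //.
by rewrite invr_eq0.
Qed.

(** Both functions generate k(t) and vanish at R, so each is a unit times a positive power of the
    other; the two exponents have product 1. *)
Lemma rational_generator_param (R : coords C) q b : lies_above R q ->
  in_max_ideal R (u - i b) ->
  exists2 w, is_local_unit R w & u - i b = w * param K q.
Proof.
move=> [onR mq] mu; have q0 := param_neq0 q.
have u0 : u - i b != 0.
  by rewrite subr_eq0; apply/eqP; apply: rational_generator_const.
have [a [w [uw qE]]] : exists (a : int) w,
    is_local_unit R w /\ param K q = w * (u - i b) ^ a.
  apply: (@simple_ext_local _ _ _ _ R onR u) => //; first by left; exists b.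
  by apply/genu/(@param_generator k K q); apply: simple_ext_gen.
have [a' [w' [uw' uE]]] : exists (a : int) w,
    is_local_unit R w /\ u - i b = w * param K q ^ a.
  apply: (@simple_ext_local _ _ _ _ R onR t) => //; first exact: param_shape.
  apply: simple_ext_add; first by apply/genu; apply: simple_ext_gen.
  by apply: simple_ext_opp; apply: simple_ext_const.
have a_gt0 : 0 < a by apply: (unit_exp_in_max onR u0 mu uw); rewrite -qE.
have a'_gt0 : 0 < a' by apply: (unit_exp_in_max onR q0 mq uw'); rewrite -uE.
have a'1 : a' = 1.
  suff : 1 = a' * a by move: a_gt0 a'_gt0; nia.
  apply: (@unit_exp_uniq _ _ _ _ R onR (param K q) 1 (w * w' ^ a)) => //.
  - exact: unit1.
  - by apply: unit_mul => //; apply: unit_expz.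
  by rewrite expr1z mul1r {1}qE uE expfzMl -exprz_exp mulrA.
by exists w' => //; rewrite {1}uE a'1 expr1z.
Qed.

End PointsOverLine.

(** * The Galois action at a point *)

Section GaloisAction.

Variables (k : closedFieldType) (K : splittingFieldType {fraction {poly k}}).
Local Notation i := (constK K).

Lemma gal_fixes_ext (s : gal_of {:K}) (z : K) :
  s \in 'Gal({:K} / 1)%g -> z \in 1%VS -> s z = z.
Proof. by move=> sG; apply: fixed_gal sG; apply: sub1v. Qed.

Lemma gal_const (s : gal_of {:K}) c : s \in 'Gal({:K} / 1)%g -> s (i c) = i c.
Proof.
by move=> sG; apply: gal_fixes_ext => //; apply/simple_ext_tKP/simple_ext_const.
Qed.

Lemma gal_param (s : gal_of {:K}) q :
  s \in 'Gal({:K} / 1)%g -> s (param K q) = param K q.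
Proof.
move=> sG; apply: gal_fixes_ext => //.
by apply/(rational_generatorP (@param_generator k K q)); apply: simple_ext_gen.
Qed.

Lemma gal_expg_eigen (s : gal_of {:K}) (c : k) (z : K) m :
  s \in 'Gal({:K} / 1)%g -> s z = i c * z -> (s ^+ m)%g z = i (c ^+ m) * z.
Proof.
move=> sG sz; elim: m => [|m IH].
  by rewrite expg0 gal_id expr0 rmorph1 mul1r.
rewrite expgS galM ?memvf // sz rmorphM /= IH gal_const ?groupX //.
by rewrite exprS [RHS](congr1 ( *%R^~ z) (rmorphM i _ _)) mulrA.
Qed.

Variables (C : proj_variety i) (R : coords C) (s : gal_of {:K}).
Hypotheses (onR : on_variety R) (sG : s \in 'Gal({:K} / 1)%g).
Hypothesis sR : stabilises s R.

Lemma gal_max z : in_max_ideal R z -> in_max_ideal R (s z).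
Proof.
move=> mz; have [->|z0] := eqVneq z 0.
  by rewrite rmorph0 -(rmorph0 i); apply/in_max_value/value_at_const.
have [//|[_ _ Osz]] := local_max_or_unit onR ((sR z).1 (max_in_local onR mz)).
case: (max_not_unit onR mz); split=> //; first exact: max_in_local.
by apply/sR; rewrite fmorphV.
Qed.

Lemma gal_value z c : value_at R z c -> value_at R (s z) c.
Proof.
by move=> /gal_max; rewrite rmorphB /= gal_const.
Qed.

(* The tame character: s multiplies a uniformiser, hence its m-th power times *)
(* any unit, by a function whose value at R is the m-th power of eps.         *)
Lemma gal_eigenvalue (pi z v w : K) (eps del : k) (m : int) :
  is_uniformiser R pi -> in_local_ring R w -> eps != 0 ->
  s pi - i eps * pi = pi ^+ 2 * w ->
  is_local_unit R v -> z = v * pi ^ m -> s z = i del * z -> del = eps ^ m.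
Proof.
move=> [pi0 mpi _] Ow eps0 spi uv zE sz.
have pi_val : value_at R (s pi / pi) eps.
  have -> : s pi / pi = i eps + w * pi.
    by rewrite -[s pi](subrK (i eps * pi)) spi; field.
  rewrite -[X in value_at _ _ X]addr0.
  apply: value_at_add (value_at_const _ _) _ => //.
  by apply: (in_max_value R _).1; apply: max_mulr.
have v_val : value_at R (s v / v) 1.
  have [c c0 vc] := (local_unit_value onR v).1 uv; rewrite -(mulfV c0).
  by apply: value_at_mul => //; [apply: gal_value | apply: value_at_inv].
have [v0 _ _] := uv.
suff /(value_at_uniq onR (value_at_const onR del)) : value_at R (i del) (eps ^ m) by [].
have -> : i del = (s v / v) * (s pi / pi) ^ m.
  have z0 : z != 0 by rewrite zE mulf_neq0 // expfz_neq0.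
  apply: (mulIf z0); rewrite -sz zE rmorphM /= fmorphXz mulrACA divfK //.
  by rewrite -expfzMl divfK.
by rewrite -[eps ^ m]mul1r; apply: value_at_mul => //; apply: value_at_expz.
Qed.

End GaloisAction.

(** * The divisor of z^n for an eigenvector z of tau *)

Section BranchData.

Variables (k : closedFieldType) (K : splittingFieldType {fraction {poly k}}).
Local Notation i := (constK K).
Variables (C : proj_variety i) (n r : nat) (zeta : k).
Variables (tau : gal_of {:K}) (p : 'I_r -> option k) (l : 'I_r -> nat).
Hypothesis prim_zeta : n.-primitive_root zeta.
Hypothesis tauG : tau \in 'Gal({:K} / 1)%g.
Hypothesis dataC : branch_data C n zeta tau p l.

Variables (z : K) (c : nat).
Hypotheses (z0 : z != 0) (tz : tau z = i (zeta ^+ c) * z).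

Let n_gt0 : (0 < n)%N := prim_order_gt0 prim_zeta.

Lemma order_eq (R : coords C) q e pi w v u (m : int) a :
  lies_above R q -> is_uniformiser R pi -> is_local_unit R w ->
  param K q = w * pi ^ e%:Z -> is_local_unit R v -> z = v * pi ^ m ->
  is_local_unit R u -> z ^+ n = u * param K q ^+ a -> m * n%:Z = e%:Z * a%:Z.
Proof.
move=> [onR _] [pi0 mpi _] uw qE uv zE uu znE.
apply: (unit_exp_uniq onR pi0 mpi (w := v ^ n%:Z) (w' := u * w ^ a%:Z)).
- exact: unit_expz.
- by apply: unit_mul => //; apply: unit_expz.
by rewrite -!exprz_exp -mulrA -!expfzMl -qE -zE.
Qed.

(** Let m be the order of z at R. The tame character gives zeta^(c l_j) = zeta^((n/e) m), and the
    order of z^n gives n m = e a. Once e divides n, (n/e) m = a. *)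
Lemma branch_congruence (R : coords C) (j : 'I_r) (e : nat) (u : K) (a : nat) :
  coprime c n -> lies_above R (p j) -> ramification_index R (p j) e ->
  is_local_unit R u -> z ^+ n = u * param K (p j) ^+ a ->
  c * l j = a %[mod n].
Proof.
move=> copc Rq ramR uu znE; have [_ _ /(_ j)/andP[l_gt0 ltln] dist] := dataC.
have [_ sR _ spi] := dist j R e Rq ramR; set s := (tau ^+ l j)%g in sR spi.
have sG : s \in 'Gal({:K} / 1)%g by rewrite groupX.
have [onR mq] := Rq.
have [pi [w [upi uw qE]]] := ramR; have [w' [Ow' {}spi]] := spi pi upi.
set eps := zeta ^+ (n %/ e) in spi.
have eps0 : eps != 0.
  rewrite expf_neq0 //; apply: contraTneq (oner_neq0 k) => zeta0.
  by rewrite negbK -(prim_expr_order prim_zeta) zeta0 expr0n gtn_eqF.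
have [pi0 mpi piE] := upi.
have [m [v [uv zE]]] := piE z z0.
have sz : s z = i (zeta ^+ (c * l j)) * z.
  by rewrite exprM; apply: gal_expg_eigen.
have zl : zeta ^+ (c * l j) = eps ^ m :=
  gal_eigenvalue onR sG sR upi Ow' eps0 spi uv zE sz.
(* The tame character applied to [param K (p j)], which has order e and is fixed by s; this is what
   will show that e divides n. *)
have epse : 1 = eps ^ e%:Z.
  apply: (gal_eigenvalue onR sG sR upi Ow' eps0 spi uw qE).
  by rewrite rmorph1 mul1r gal_param.
have dvdne : (n %| n %/ e * e)%N.
  by rewrite (prim_order_dvd prim_zeta) exprM -exprnP in epse *; rewrite epse.
have mn := order_eq Rq upi uw qE uv zE uu znE.
(* A zero quotient, from e = 0 or e > n, would make [eps] equal to 1, so n would divide c l_j and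
   then l_j, against 0 < l_j < n. *)
have f_gt0 : (0 < n %/ e)%N.
  rewrite lt0n; apply: contraTneq ltln => f0; rewrite -leqNgt dvdn_leq //.
  rewrite -(Gauss_dvdr (m := n) (n := c)); last by rewrite coprime_sym.
  by rewrite (prim_order_dvd prim_zeta) zl /eps f0 expr0 exp1rz.
have e_gt0 : (0 < e)%N by move: f_gt0; case: (e) => //; rewrite divn0.
have nE : (n %/ e * e = n)%N.
  apply/eqP; rewrite eqn_leq leq_divM dvdn_leq // muln_gt0 f_gt0 //.
apply/eqP; rewrite -(eq_prim_root_expr prim_zeta); apply/eqP.
rewrite zl /eps exprnP exprz_exp [RHS]exprnP; congr (_ ^ _).
apply: (mulfI (x := e%:Z)); first by rewrite eqz_nat -lt0n.
by rewrite -mn mulrA [e%:Z * _]mulrC -PoszM nE mulrC.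
Qed.

(** Here the ramification index is 1, so a is the order of z^n at R, which is n times that of z. *)
Lemma unbranched_dvdn (R : coords C) q (u : K) (a : nat) :
  smooth_curve C -> lies_above R q -> (forall j, p j != q) ->
  is_local_unit R u -> z ^+ n = u * param K q ^+ a -> (n %| a)%N.
Proof.
move=> smoothC Rq npq uu znE; have [onR mq] := Rq.
have [pi upi] := smoothC R onR; have [pi0 mpi piE] := upi.
have [e [w [uw qE]]] := piE _ (param_neq0 K q).
have e_gt0 : 0 < e by apply: (unit_exp_in_max onR pi0 mpi uw); rewrite -qE.
have [m [v [uv zE]]] := piE z z0.
case: e e_gt0 qE => // e e_gt0 qE.
have e1 : e = 1%N.
  case: (ltngtP e 1%N) => [|e1|//]; first by move: e_gt0; case: (e).
  have [_ br _ _] := dataC; have [|j pj] := (br q).1; last by case/eqP: (npq j).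
  by exists R, e; split=> //; exists pi, w.
have := order_eq Rq upi uw qE uv zE uu znE.
rewrite e1 mul1r => mn; rewrite -[(n %| a)%N]/(n%:Z %| a%:Z)%Z -mn.
exact: dvdz_mull.
Qed.

End BranchData.

(** * Eigenvectors and plane models *)

Lemma separable_multiplicity (k : fieldType) (h q : {poly k}) b m :
  separable_poly h -> h = q * ('X - b%:P) ^+ m -> (m <= 1)%N.
Proof.
case: m => [|[|m]] // sep hE; move: sep.
rewrite hE exprSr mulrA separable_root => /andP[_ /negP[]].
by rewrite /root exprSr mulrA hornerM hornerXsubC subrr mulr0.
Qed.

(** A common root b of G and its derivative has multiplicity at least 2; as this is 0 or 1 modulo n,
    it is at least n. Dividing by (X - b)^n keeps all multiplicities modulo n and lowers the
    degree. *)
Lemma separable_nth_power_part (k : closedFieldType) (n : nat) (G : {poly k}) :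
  (1 < n)%N -> G != 0 ->
  (forall b q m, ~~ root q b -> G = q * ('X - b%:P) ^+ m ->
     (m %% n <= 1)%N) ->
  exists h E : {poly k}, separable_poly h /\ G = h * E ^+ n.
Proof.
move=> n_gt1; elim: {G}(size G) {-2}G (leqnn (size G)) => [|N IH] G leGN G0 mG.
  by rewrite -size_poly_gt0 ltnNge leGN in G0.
have [sepG|nsepG] := boolP (separable_poly G).
  by exists G, 1; rewrite expr1n mulr1.
have /closed_rootP[b] : size (gcdp G G^`()) != 1%N.
  by move: nsepG; rewrite unlock.
rewrite root_gcd => /andP[Gb G'b].
have [m [q]] := multiplicity_XsubC G b; rewrite G0 /= => qb GE.
have m_gt1 : (1 < m)%N.
  case: m GE => [|[|//]] GE; first by rewrite GE expr0 mulr1 (negPf qb) in Gb.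
  move: G'b; rewrite GE expr1 derivM derivXsubC mulr1 /root hornerD hornerM.
  by rewrite hornerXsubC subrr mulr0 add0r -/(root q b) (negPf qb).
have lenm : (n <= m)%N.
  rewrite leqNgt; apply/negP => ltmn; have := mG b q m qb GE.
  by rewrite modn_small // leqNgt m_gt1.
pose G1 := q * ('X - b%:P) ^+ (m - n).
have GG1 : G = G1 * ('X - b%:P) ^+ n by rewrite GE -mulrA -exprD subnK.
have G10 : G1 != 0 by apply: contraNneq G0 => G10; rewrite GG1 G10 mul0r.
have [||c q1 m1 q1c G1E|h [E [seph G1E]]] := IH G1.
- rewrite -ltnS (leq_trans _ leGN) // GG1.
  rewrite (size_Mmonic G10) ?monic_exp ?monicXsubC // size_exp_XsubC.
  by rewrite addnS /= -addn1 leq_add2l ltnW.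
- exact: G10.
- have [cb|cb] := eqVneq c b.
    rewrite -(modnDr m1); apply: (mG c q1) => //.
    by rewrite GG1 G1E cb -mulrA exprD.
  apply: (mG c (q1 * ('X - b%:P) ^+ n)); last by rewrite GG1 G1E mulrAC.
  rewrite /root hornerM horner_exp hornerXsubC mulf_neq0 //.
  by rewrite expf_neq0 // subr_eq0.
exists h, (E * ('X - b%:P)); split=> //.
by rewrite exprMn mulrA -G1E.
Qed.

Section CyclicGenerator.

Variables (k : closedFieldType) (K : splittingFieldType {fraction {poly k}}).
Local Notation i := (constK K).
Local Notation t := (tK K).
Variables (n : nat) (zeta : k) (tau : gal_of {:K}).
Hypothesis prim_zeta : n.-primitive_root zeta.
Hypothesis tauG : tau \in 'Gal({:K} / 1)%g.
Hypothesis degK : \dim {:K} = n.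

Variables (u v : K) (c : nat).
Hypothesis genu : rational_generator u.

Lemma gal_horner_fixed (s : gal_of {:K}) (q : {poly K}) (x : K) :
  s \in 'Gal({:K} / 1)%g -> (forall j, q`_j \in 1%VS) -> s q.[x] = q.[s x].
Proof.
move=> sG q1; rewrite -horner_map /=; congr _.[_].
by apply/polyP => j; rewrite coef_map /= (gal_fixes_ext sG (q1 j)).
Qed.

Lemma gal_eval2_fixed (s : gal_of {:K}) (F : {poly {poly k}}) (x : K) :
  s \in 'Gal({:K} / 1)%g -> s (eval2 i F u x) = eval2 i F u (s x).
Proof.
move=> sG; rewrite !eval2E gal_horner_fixed // => j.
by rewrite coef_map; apply/(rational_generatorP genu)/simple_ext_horner/simple_ext_gen.
Qed.

Hypothesis v0 : v != 0.
Hypothesis tv : tau v = i (zeta ^+ c) * v.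

(** With d = gcd(c, n), tau^(n/d) fixes u and v, hence all of K. Since tau has order n, d = 1. *)
Lemma eigen_generates_coprime :
  #[tau]%g = n ->
  (forall z, exists P Q, eval2 i Q u v != 0 /\ z = eval2 i P u v / eval2 i Q u v) ->
  coprime c n.
Proof.
move=> ord_tau gen_uv; have n_gt0 := prim_order_gt0 prim_zeta.
set d := gcdn c n; have d_gt0 : (0 < d)%N by rewrite gcdn_gt0 n_gt0 orbT.
set s := (tau ^+ (n %/ d))%g; have sG : s \in 'Gal({:K} / 1)%g by rewrite groupX.
have sv : s v = v.
  rewrite (gal_expg_eigen _ tauG tv) -exprM.
  have -> : (c * (n %/ d) = c %/ d * n)%N.
    by rewrite -{1}(divnK (dvdn_gcdl c n)) -mulnA [(_ * (n %/ d))%N]mulnC divnK ?dvdn_gcdr.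
  by rewrite [(_ * n)%N]mulnC exprM (prim_expr_order prim_zeta) expr1n rmorph1 mul1r.
have s1 : s = 1%g.
  apply/eqP/gal_eqP => z _; rewrite gal_id.
  have [P [Q [_ ->]]] := gen_uv z.
  by rewrite fmorph_div /= !gal_eval2_fixed // sv.
have : (#[tau]%g %| n %/ d)%N by rewrite order_dvdn; apply/eqP.
rewrite ord_tau => /dvdn_leq; rewrite divn_gt0 // dvdn_leq ?dvdn_gcdr // => /(_ isT).
rewrite /coprime -/d; case: (d) d_gt0 => [|[|d']] // _.
by rewrite leqNgt ltn_Pdiv.
Qed.

Hypothesis copc : coprime c n.

(** The coefficients are fixed by tau, so q vanishes at the n conjugates zeta^(c m) v, which are
    distinct because c is prime to n. *)
Lemma eigen_poly_eq0 (q : {poly K}) : (forall j, q`_j \in 1%VS) -> q.[v] = 0 ->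
  (size q <= n)%N -> q = 0.
Proof.
move=> q1 qv szq; apply/eqP/idPn => q0.
pose rs := [seq i (zeta ^+ (c * m)) * v | m <- iota 0 n].
suff : (size rs < size q)%N by rewrite size_map size_iota ltnNge szq.
apply: max_poly_roots => //.
  apply/allP => _ /mapP[m _ ->]; apply/eqP.
  rewrite exprM -(gal_expg_eigen m tauG tv) -gal_horner_fixed ?groupX //.
  by rewrite qv rmorph0.
rewrite map_inj_in_uniq ?iota_uniq // => m m'; rewrite !mem_iota !add0n /=.
move=> ltm ltm' /(mulIf v0) zz; have /eqP := fmorph_inj i zz.
have prim_c : n.-primitive_root (zeta ^+ c) by rewrite prim_root_exp_coprime.
by rewrite !exprM (eq_prim_root_expr prim_c) !modn_small // => /eqP.
Qed.

(** By [eigen_poly_eq0], v has degree n over k(t) and so generates K. A polynomial vanishing at (u,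
    v) has, after division by the monic Y^n - h, a remainder of degree below n in Y that vanishes
    there too, so it is zero. *)
Lemma eigen_birational (h : {poly k}) :
  v ^+ n = (map_poly i h).[u] -> birational_to_plane_curve i ('X^n - h%:P) u v.
Proof.
move=> vn; have n_gt0 := prim_order_gt0 prim_zeta.
set F := _ - _; have monF : F \is monic.
  rewrite monicE lead_coefDl ?lead_coefXn //.
  by rewrite size_polyN size_polyXn ltnS (leq_trans (size_polyC_leq1 _)).
have szF : size F = n.+1.
  rewrite /F size_polyDl ?size_polyXn // size_polyN ltnS.
  exact: leq_trans (size_polyC_leq1 _) n_gt0.
have Fuv : eval2 i F u v = 0.
  rewrite eval2E rmorphB /= map_polyXn map_polyC hornerD hornerN hornerXn hornerC.
  by rewrite vn subrr.
have ext1 (A : {poly k}) : (map_poly i A).[u] \in 1%VS.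
  by apply/(rational_generatorP genu)/simple_ext_horner/simple_ext_gen.
split=> [P|z].
  split=> [Puv|[Q ->]]; last by rewrite eval2E rmorphM hornerM -!eval2E Fuv mulr0.
  exists (Pdiv.Ring.rdivp P F); have := Pdiv.RingMonic.rdivp_eq monF P.
  set Q := Pdiv.Ring.rdivp P F; set R := Pdiv.Ring.rmodp P F => PE.
  suff R0 : R = 0 by rewrite {1}PE R0 addr0.
  have mR0 : map_poly (poly_at i u) R = 0.
    apply: eigen_poly_eq0 => [j||].
    - by rewrite coef_map; apply: ext1.
    - move: Puv; rewrite PE eval2E rmorphD rmorphM hornerD hornerM -!eval2E.
      by rewrite Fuv mulr0 add0r.
    rewrite (leq_trans (size_poly _ _)) // -ltnS -szF.
    by rewrite Pdiv.Ring.ltn_rmodpN0 // monic_neq0.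
  apply/polyP => j; rewrite coef0; apply: (rational_generator_transc genu).
  by have := coef_map (poly_at i u) R j; rewrite mR0 coef0.
have full : <<1; v>>%VS = {:K}%VS.
  apply/eqP; rewrite eqEdim subvf degK dim_Fadjoin dimv1 muln1 /=.
  rewrite -ltnS -size_minPoly ltnNge; apply/negP => szm.
  have /eqP := monic_neq0 (monic_minPoly 1 v); apply.
  apply: eigen_poly_eq0 => //; last exact: minPolyxx.
  by move=> j; apply/polyOverP/minPolyOver.
have /Fadjoin_polyP[q /polyOverP q1 ->] : z \in <<1; v>>%VS by rewrite full memvf.
have [|D [P [D0 PE]]] := @common_denominator _ _ i u q.
  by move=> j; apply/(rational_generatorP genu).
exists P, D%:P; rewrite !eval2E map_polyC hornerC PE hornerZ; split=> //.
by rewrite mulrC mulKf.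
Qed.

End CyclicGenerator.

Lemma ramification_exists (k : closedFieldType)
    (K : splittingFieldType {fraction {poly k}}) (C : proj_variety (constK K))
    (R : coords C) q : smooth_curve C -> lies_above R q ->
  exists e, ramification_index R q e.
Proof.
move=> smoothC [onR mq]; have [pi upi] := smoothC R onR.
have [pi0 mpi piE] := upi; have [e [w [uw qE]]] := piE _ (param_neq0 K q).
have e_gt0 : 0 < e by apply: (unit_exp_in_max onR pi0 mpi uw); rewrite -qE.
by case: e e_gt0 qE => // e _ qE; exists e, pi, w.
Qed.

(** The coordinate has its pole at q0: it is t if q0 is infinity and 1/(t - a) if q0 = a. Each
    finite value b is then taken at a point other than q0. *)
Lemma coordinate_avoiding (k : closedFieldType)
    (K : splittingFieldType {fraction {poly k}}) (q0 : option k) :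
  exists2 u : K, rational_generator u &
    forall b, exists2 q, q != q0 &
      forall (C : proj_variety (constK K)) (R : coords C),
        lies_above R q -> in_max_ideal R (u - constK K b).
Proof.
case: q0 => [a|]; last first.
  exists (tK K); first by [].
  by move=> b; exists (Some b) => // C R [].
set s := param K (Some a); have s0 : s != 0 := param_neq0 K (Some a).
have gs : rational_generator s := @param_generator k K (Some a).
exists s^-1.
  apply: rational_generatorI.
    by apply/simple_ext_inv/gs/simple_ext_gen.
  apply: (@simple_ext_trans _ _ _ s^-1 s).
    by rewrite -{2}[s]invrK; apply/simple_ext_inv/simple_ext_gen.
  by apply/gs/simple_ext_gen.
move=> b; have [->|b0] := eqVneq b 0.
  exists None => // C R [onR mt]; rewrite rmorph0 subr0.
  have t0 := rational_generator_neq0 (@param_generator k K None).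
  have val1 : value_at R (1 - constK K a * param K None) 1.
    rewrite -[X in value_at _ _ X]subr0; apply: value_at_sub => //.
      by rewrite -[X in value_at _ X _](rmorph1 (constK K)); apply: value_at_const.
    by apply: (in_max_value R _).1; apply: max_mulr => //; apply: local_const.
  have -> : s^-1 = (1 - constK K a * param K None)^-1 * param K None.
    have tn0 : tK K != 0 by move: t0; rewrite invr_eq0.
    rewrite /s /= -invfM; congr _^-1; rewrite mulrBl mul1r.
    by rewrite -mulrA mulVf ?mulr1.
  apply: max_mulr => //; apply/in_local_value => //; exists 1.
  by rewrite -[X in value_at _ _ X]invr1; apply: value_at_inv; rewrite ?oner_eq0.
(* The solution of 1/(t - a) = b. *)
exists (Some (a + b^-1)).
  by apply: contraNneq b0 => -[/eqP]; rewrite -subr_eq0 addrAC subrr add0r invr_eq0.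
move=> C R [onR mq]; set q := Some _ in mq.
have sE : s = param K q + constK K b^-1.
  by rewrite /s /q /param (rmorphD (constK K) a b^-1) opprD addrA subrK.
have sval : value_at R s b^-1.
  rewrite sE -[X in value_at _ _ X]add0r; apply: value_at_add (value_at_const _ _) => //.
  exact: (in_max_value R _).1.
have ib0 : constK K b != 0 by rewrite fmorph_eq0.
have -> : s^-1 - constK K b = (- constK K b * s^-1) * param K q.
  have -> : param K q = s - (constK K b)^-1 by rewrite sE fmorphV addrK.
  by move: (constK K b) ib0 => B B0; field; rewrite s0 B0.
apply: max_mulr => //; apply/in_local_value => //; exists (- b * b).
apply: value_at_mul => //; first by apply: value_at_opp => //; apply: value_at_const.
by rewrite -[X in value_at _ _ X]invrK; apply: value_at_inv; rewrite ?invr_eq0.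
Qed.

(** * The two implications *)

Section SuperellipticModels.

Variables (k : closedFieldType) (K : splittingFieldType {fraction {poly k}}).
Variables (C : proj_variety (constK K)) (n r : nat) (zeta : k).
Variables (tau : gal_of {:K}) (p : 'I_r -> option k) (l : 'I_r -> nat).
Hypotheses (smoothC : smooth_curve C) (n_gt1 : (1 < n)%N).
Hypotheses (prim_zeta : n.-primitive_root zeta) (galK : galois 1%VS {:K}).
Hypotheses (degK : \dim {:K} = n) (gen_tau : generator 'Gal({:K} / 1)%g tau).
Hypothesis dataC : branch_data C n zeta tau p l.
Local Notation i := (constK K).

Lemma generator_in_gal : tau \in 'Gal({:K} / 1)%g.
Proof. by rewrite (eqP gen_tau) cycle_id. Qed.

Lemma generator_gal_order : #[tau]%g = n.
Proof.
by rewrite -degK orderE -(eqP gen_tau) -galois_dim // dimv1 divn1.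
Qed.

Lemma gal_fixed_in_base z : tau z = z -> z \in 1%VS.
Proof.
move=> tz; rewrite -((galois_fixedField (E := {:K}%AS)) galK).
apply/fixedFieldP; rewrite ?memvf // => s; rewrite (eqP gen_tau) => /cycleP[m ->].
have := @gal_expg_eigen _ _ tau 1 z m generator_in_gal.
by rewrite rmorph1 mul1r expr1n rmorph1 mul1r; apply.
Qed.

(** Hilbert 90 for the constant zeta, whose norm is zeta^n = 1. *)
Lemma eigenvector_exists : exists2 y : K, y != 0 & tau y = i zeta * y.
Proof.
have norm1 : galNorm 1 {:K} (i zeta) == 1.
  rewrite /galNorm (eq_bigr (fun=> i zeta)) => [|s sG]; last exact: gal_const.
  rewrite prodr_const -galois_dim // dimv1 divn1 degK.
  by rewrite -(rmorphXn i) (prim_expr_order prim_zeta) (rmorph1 i).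
have [b [_ b0] zE] := Hilbert's_theorem_90 gen_tau (memvf (i zeta)) norm1.
exists b^-1; first by rewrite invr_eq0.
by rewrite zE fmorphV mulrAC mulfV // mul1r.
Qed.

Lemma superelliptic_branch_data (h : {poly k}) (u v : K) :
  separable_poly h -> rational_generator u ->
  birational_to_plane_curve i ('X^n - h%:P) u v ->
  exists c : nat, coprime c n /\
     (#|[set j : 'I_r | c * l j != 1 %[mod n]]| <= 1)%N.
Proof.
move=> seph genu [Fker Fgen]; have tauG := generator_in_gal.
have n_gt0 := ltnW n_gt1; have h0 := separable_poly_neq0 seph.
have vn : v ^+ n = (map_poly i h).[u].
  have /Fker : exists Q, 'X^n - h%:P = Q * ('X^n - h%:P) by exists 1; rewrite mul1r.
  rewrite eval2E rmorphB /= map_polyXn map_polyC hornerD hornerN hornerXn hornerC.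
  by move/eqP; rewrite subr_eq0 => /eqP.
have hu0 : (map_poly i h).[u] != 0.
  by apply: contraNneq h0 => /(rational_generator_transc genu)/eqP.
have v0 : v != 0.
  by apply: contraNneq hu0 => v0; rewrite -vn v0 expr0n gtn_eqF.
have u1 : (map_poly i h).[u] \in 1%VS.
  by apply/(rational_generatorP genu)/simple_ext_horner/simple_ext_gen.
(* As v^n lies in k(t), tau v / v is an n-th root of unity. *)
have [c tv] : exists c, tau v = i (zeta ^+ c) * v.
  have prim_izeta : n.-primitive_root (i zeta) by rewrite fmorph_primitive_root.
  have [|c cE] := prim_rootP prim_izeta (x := tau v / v).
    rewrite expr_div_n -rmorphXn vn /= (gal_fixes_ext tauG u1) divff //.
  by exists c; rewrite rmorphXn /= -cE divfK.
have copc := eigen_generates_coprime prim_zeta tauG genu tv generator_gal_order Fgen.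
exists c; split=> //; apply/card_le1_eqP => j j'; rewrite !inE.
(* If u took a finite value b at R, then c l_x would be congruent to the multiplicity of b in h,
   which is 0 or 1. The value 1 is excluded by assumption, and 0 would make n divide l_x. *)
have pole x : c * l x != 1 %[mod n] ->
    exists2 R : coords C, lies_above R (p x) & in_max_ideal R u^-1.
  move=> clx; have [_ /(_ (p x))[_ []]] := dataC; first by exists x.
  move=> R [e [Rq ramR _]] _ _; exists R => //; have [onR mq] := Rq.
  have [Ou|//] := smooth_local_or_inv onR smoothC (rational_generator_neq0 genu).
  have [b ub] := (in_local_value onR u).1 Ou.
  have [w uw uE] := rational_generator_param genu Rq ub.
  have [m [q]] := multiplicity_XsubC h b; rewrite h0 /= => qb hE.
  have [w' uw' huE] := horner_local_zero onR m ub qb.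
  rewrite -hE -vn uE exprMn mulrA in huE.
  have uw'' : is_local_unit R (w' * w ^+ m).
    by apply: unit_mul => //; apply: (unit_expz onR m).
  have clm := branch_congruence prim_zeta tauG dataC v0 tv copc Rq ramR uw'' huE.
  have [_ _ /(_ x)/andP[lx_gt0 ltlx] _] := dataC.
  have := separable_multiplicity seph hE; case: (m) clm => [|[|//]] clm _; last first.
    by rewrite clm eqxx in clx.
  have : (n %| c * l x)%N by rewrite /dvdn clm mod0n.
  rewrite Gauss_dvdr; last by rewrite coprime_sym.
  by move/(dvdn_leq lx_gt0); rewrite leqNgt ltlx.
move=> /pole[R Rj mR] /pole[R' Rj' mR'].
by have [+ _ _ _] := dataC; apply; exact (pole_uniq genu Rj' Rj mR' mR).
Qed.

Lemma superelliptic_model (c : nat) : coprime c n ->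
  (#|[set j : 'I_r | c * l j != 1 %[mod n]]| <= 1)%N ->
  exists (h : {poly k}) (u v : K), [/\ separable_poly h, rational_generator u
    & birational_to_plane_curve i ('X^n - h%:P) u v].
Proof.
move=> copc /card_le1_eqP exc; have tauG := generator_in_gal.
have n_gt0 := ltnW n_gt1.
(* The exceptional branch point, or infinity as a default when there is none. *)
have [q0 q0E] : exists q0, forall j, p j != q0 -> c * l j = 1 %[mod n].
  have [j0 excj0|noexc] := pickP (mem [set j : 'I_r | c * l j != 1 %[mod n]]).
    exists (p j0) => j; apply: contra_neq_eq => excj; congr p.
    have jS : j \in [set j : 'I_r | c * l j != 1 %[mod n]] by rewrite inE.
    exact (exc j0 j excj0 jS).
  exists None => j _; apply/eqP/idPn => excj.
  by have := noexc j; rewrite /= inE excj.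
have [u genu uq] := coordinate_avoiding K q0.
have [y y0 ty] := eigenvector_exists.
have tz : tau (y ^+ c) = i (zeta ^+ c) * y ^+ c.
  by rewrite [LHS]rmorphXn /= ty exprMn -(rmorphXn i).
have ycn : in_simple_ext i u (y ^+ c ^+ n).
  apply/(rational_generatorP genu)/gal_fixed_in_base.
  rewrite [LHS]rmorphXn /= tz exprMn -(rmorphXn i) -exprM [(c * n)%N]mulnC exprM.
  by rewrite (prim_expr_order prim_zeta) expr1n (rmorph1 i) mul1r.
have [A [B [B0 ycE]]] := ycn.
(* Multiplying by B(u), which tau fixes, clears the denominator of (y^c)^n = A(u)/B(u) and keeps the
   eigenvalue. *)
pose v0 := y ^+ c * (map_poly i B).[u]; pose G := A * B ^+ n.-1.
have v0_neq0 : v0 != 0 by rewrite mulf_neq0 // expf_neq0.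
have ext1 (D : {poly k}) : tau (map_poly i D).[u] = (map_poly i D).[u].
  apply: gal_fixes_ext => //.
  by apply/(rational_generatorP genu)/simple_ext_horner/simple_ext_gen.
have tv0 : tau v0 = i (zeta ^+ c) * v0 by rewrite rmorphM /= tz ext1 mulrA.
have v0n : v0 ^+ n = (map_poly i G).[u].
  rewrite exprMn ycE rmorphM rmorphXn hornerM horner_exp /=.
  by rewrite -[in LHS](prednK n_gt0) exprS mulrA divfK.
move: v0 v0_neq0 tv0 v0n => v0 v0_neq0 tv0 v0n.
have G0 : G != 0.
  have : v0 ^+ n != 0 by rewrite expf_neq0.
  by apply: contraNneq => G0; rewrite v0n G0 rmorph0 horner0.
(* The multiplicity m of b in G is read at a point R of C above the point q1 where u = b. Since q1
   differs from q0, m is 1 modulo n if q1 is a branch point and 0 otherwise. *)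
have [//|//|b q m qb GE|h [E [seph GhE]]] := @separable_nth_power_part k n G.
  have [q1 q1q0 mq1] := uq b; have [R Rq] := center_over q1 smoothC.
  have [onR _] := Rq; have mb := mq1 C R Rq.
  have [w uw uE] := rational_generator_param genu Rq mb.
  have [w' uw' GuE] := horner_local_zero onR m mb qb.
  rewrite -GE -v0n uE exprMn mulrA in GuE.
  have uw'' : is_local_unit R (w' * w ^+ m).
    by apply: unit_mul => //; apply: (unit_expz onR m).
  have [j /eqP pj|np] := pickP (fun j => p j == q1); last first.
    have /eqP := unbranched_dvdn dataC v0_neq0 smoothC Rq (fun j => negbT (np j)) uw'' GuE.
    by rewrite /dvdn => ->.
  have [e ramR] := ramification_exists smoothC Rq; rewrite -pj in Rq ramR GuE.
  rewrite -(branch_congruence prim_zeta tauG dataC v0_neq0 tv0 copc Rq ramR uw'' GuE).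
  by rewrite q0E ?pj // modn_small.
have Eu0 : (map_poly i E).[u] != 0.
  have : v0 ^+ n != 0 by rewrite expf_neq0.
  apply: contraNneq => E0; rewrite v0n GhE rmorphM rmorphXn hornerM horner_exp E0.
  by rewrite expr0n gtn_eqF // mulr0.
pose v := v0 / (map_poly i E).[u]; exists h, u, v; split=> //.
apply: (eigen_birational prim_zeta tauG degK genu (c := c)) => //.
- by rewrite mulf_neq0 ?invr_eq0.
- by rewrite fmorph_div /= tv0 ext1 mulrA.
by rewrite expr_div_n v0n GhE rmorphM rmorphXn hornerM horner_exp mulfK // expf_neq0.
Qed.

End SuperellipticModels.

Theorem theorem4p5 (k : closedFieldType)
    (K : splittingFieldType {fraction {poly k}})
    (C : proj_variety (constK K)) (g n r : nat) (zeta : k)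
    (tau : gal_of {:K}) (p : 'I_r -> option k) (l : 'I_r -> nat)
    (char0 : [pchar k] =i pred0)
    (smoothC : smooth_curve C) (genusC : has_genus C g) (ge2g : (2 <= g)%N)
    (ge2n : (2 <= n)%N) (prim_zeta : n.-primitive_root zeta)
    (galK : galois 1%VS {:K}) (cycK : cyclic 'Gal({:K} / 1)%g)
    (degK : \dim {:K} = n) (gen_tau : generator 'Gal({:K} / 1)%g tau)
    (dataC : branch_data C n zeta tau p l) :
  (exists (h : {poly k}) (u v : K),
     [/\ separable_poly h,
         forall z, in_simple_ext (constK K) u z <->
                   in_simple_ext (constK K) (tK K) z
       & birational_to_plane_curve (constK K) ('X^n - h%:P) u v])
  <->
  (exists c : nat, coprime c n /\
     (#|[set j : 'I_r | c * l j != 1 %[mod n]]| <= 1)%N).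
Proof.
split=> [[h [u [v [seph genu birat]]]]|[c [copc exc]]].
  exact: (superelliptic_branch_data smoothC ge2n prim_zeta galK degK gen_tau
    dataC seph genu birat).
have [h [u [v [seph genu birat]]]] :=
  superelliptic_model smoothC ge2n prim_zeta galK degK gen_tau dataC copc exc.
by exists h, u, v.
Qed.
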